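(* Let $\theta$ be a twisted-periodic $1$-form on an open set $\mathfrak Q\subset\mathbb C$ containing $0$, let $\vartheta_t=\varsigma^*\theta_t$ be its pull-back under $\varsigma(z)=z^2$, and let $\Sigma$ be the magnetic $2$-form on $\bar{\mathcal L}^\times\mathfrak Z$ given by $$\Sigma_z(X,Y)=\int_0^1\Bigl(d\vartheta_{t_z(\tau)}|_{z_\tau}(X_\tau,Y_\tau)+(dt|_zX)_\tau\,\dot\vartheta_{t_z(\tau)}|_{z_\tau}Y_\tau-(dt|_zY)_\tau\,\dot\vartheta_{t_z(\tau)}|_{z_\tau}X_\tau\Bigr)d\tau .$$ Then $d\Sigma=0$, and $\Omega_\Sigma:=\Omega_{\rm can}+\pi^*\Sigma$ is a weak symplectic form on the cotangent bundle $T^*\bar{\mathcal L}^\times\mathfrak Z$, where $\pi$ is the base point projection and $\Omega_{\rm can}$ the canonical symplectic form.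
   Context: Identify $\mathbb C\cong\mathbb R^2$ with Euclidean inner product $\langle\cdot,\cdot\rangle_0$; $\|\cdot\|$, $\langle\cdot,\cdot\rangle$ are the $L^2([0,1],\mathbb R^2)$ norm and inner product. $\mathfrak Z:=\varsigma^{-1}(\mathfrak Q)$. Twisted-periodic means: $\theta=(\theta_t)_{t\in\mathbb R}$ is a smooth family of $1$-forms on $\mathfrak Q$ with $\dot\theta_{t+1}=\dot\theta_t$ and $\theta_{t+1}=\theta_t+df$ for some smooth $f\colon\mathfrak Q\to\mathbb R$ (dot $=$ derivative in $t$). Loop space: $\mathcal L_\pm\mathfrak Z=\{z\in C^\infty(\mathbb R,\mathfrak Z):z(\tau+1)=\pm z(\tau)\}$, $\mathcal L_\pm^\times\mathfrak Z=\mathcal L_\pm\mathfrak Z\setminus\{0\}$, $\mathcal L_\pm\mathbb C$ defined likewise with target $\mathbb C$; $\bar{\mathcal L}^\times\mathfrak Z$ is the quotient of $\mathcal L^\times_+\mathfrak Z\cup\mathcal L^\times_-\mathfrak Z$ by the free involution $z\mapsto-z$; after choosing a representative $z\in\mathcal L_\pm^\times\mathfrak Z$ its tangent vectors are $X\in\mathcal L_\pm\mathbb C$. The cotangent bundle $T^*\bar{\mathcal L}^\times\mathfrak Z$ is the quotient of $(\mathcal L_+^\times\mathfrak Z\times\mathcal L_+\mathbb C)\cup(\mathcal L_-^\times\mathfrak Z\times\mathcal L_-\mathbb C)$ by $(z,\eta)\mapsto-(z,\eta)$, with $\pi(z,\eta)=z$; tangent vectors at $(z,\eta)$ are pairs $(\hat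 z,\hat\eta)\in\mathcal L_\pm\mathbb C\times\mathcal L_\pm\mathbb C$. All forms are invariant under the sign involution and hence defined on the quotients. $t_z(\tau)=\|z\|^{-2}\int_0^\tau|z_s|^2ds$, and $(dt|_zX)_\tau=\frac{2}{\|z\|^2}\int_0^\tau\langle z_\sigma,X_\sigma\rangle_0d\sigma-\frac{2\langle z,X\rangle}{\|z\|^4}\int_0^\tau|z_\sigma|^2d\sigma$ is its derivative in $z$ in direction $X$. $\Omega_{\rm can}\bigl((\hat z^1,\hat\eta^1),(\hat z^2,\hat\eta^2)\bigr)=\langle\hat\eta^1,\hat z^2\rangle-\langle\hat\eta^2,\hat z^1\rangle$. The exterior derivative of a $2$-form $\omega$ is given by the usual formula; for constant vector fields $X,Y,Z$ it reads $d\omega(X,Y,Z)=d(\omega(Y,Z))X-d(\omega(X,Z))Y+d(\omega(X,Y))Z$. A weak symplectic form is a closed $2$-form such that for every nonzero tangent vector there is another tangent vector at the same point on which the form pairs with it to a nonzero value. *)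

(* Defs.v *)
From Stdlib Require Import Reals FunctionalExtensionality.
From Coquelicot Require Import Coquelicot.

Open Scope R_scope.

(** * Smooth maps between finite-dimensional normed spaces *)

(* For finite-dimensional [V] and open [D], existence and continuity of all
   iterated directional derivatives up to order [k] is the usual C^k. *)
Fixpoint Ck_on {V W : NormedModule R_AbsRing} (D : V -> Prop) (k : nat)
    (f : V -> W) : Prop :=
  match k with
  | O => forall x, D x -> continuous f x
  | S k' => forall v : V, exists g : V -> W,
      (forall x, D x -> is_derive (fun s : R => f (plus x (scal s v))) 0 (g x))
      /\ Ck_on D k' g
  end.

Definition smooth_on {V W : NormedModule R_AbsRing} (D : V -> Prop)
    (f : V -> W) : Prop :=
  forall k, Ck_on D k f.

(* The complex plane as a real normed space; the default structure that
   Coquelicot infers on [C] is the complex one. *)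
Notation plane := C_R_NormedModule.
Notation "U '*n' V" := (prod_NormedModule R_AbsRing U V)
  (at level 40, left associativity).

(** * Spaces of functions *)

Section FunctionModule.
Variables (U : Type) (K : Ring) (V : ModuleSpace K).

Definition fct_AbelianMonoid_mixin : AbelianMonoid.mixin_of (U -> V).
Proof.
apply (AbelianMonoid.Mixin (U -> V)
         (fun f g x => plus (f x) (g x)) (fun _ => zero));
  intros; apply functional_extensionality; intro.
- apply plus_comm.
- apply plus_assoc.
- apply plus_zero_r.
Defined.

Definition fct_AbelianGroup_mixin :
  AbelianGroup.mixin_of
    (AbelianMonoid.Pack (U -> V) fct_AbelianMonoid_mixin (U -> V)).
Proof.
apply (AbelianGroup.Mixin
         (AbelianMonoid.Pack (U -> V) fct_AbelianMonoid_mixin (U -> V))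
         (fun f x => opp (f x))).
intros f; apply functional_extensionality; intro x.
exact (plus_opp_r (f x)).
Defined.

Definition fct_AbelianGroup : AbelianGroup :=
  AbelianGroup.Pack (U -> V)
    (AbelianGroup.Class (U -> V) fct_AbelianMonoid_mixin fct_AbelianGroup_mixin)
    (U -> V).

Definition fct_ModuleSpace_mixin : ModuleSpace.mixin_of K fct_AbelianGroup.
Proof.
apply (ModuleSpace.Mixin K fct_AbelianGroup (fun a f x => scal a (f x)));
  intros; apply functional_extensionality; intro.
- apply scal_assoc.
- apply scal_one.
- apply scal_distr_l.
- apply scal_distr_r.
Defined.

Definition fct_ModuleSpace : ModuleSpace K :=
  ModuleSpace.Pack K (U -> V)
    (ModuleSpace.Class K (U -> V)
       (AbelianGroup.class fct_AbelianGroup) fct_ModuleSpace_mixin)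
    (U -> V).
End FunctionModule.

(* All functions from R to C, with pointwise operations. *)
Definition paths : ModuleSpace R_Ring := fct_ModuleSpace R R_Ring plane.

(** * Differential forms on quotients by the sign involution *)

Inductive parity := Plus | Minus.

(* The quotient by [x |-> - x] of the disjoint union of two open subsets
   [points Plus], [points Minus] of the function spaces [tangent Plus],
   [tangent Minus], both contained in [model].  A form on the quotient is an
   involution-invariant form on the double cover.  [smooth_path D c] says that
   [c] is a smooth curve in [model] with parameter in the open set [D]. *)
Record sign_quotient := SignQuotient {
  model :> ModuleSpace R_Ring;
  tangent : parity -> model -> Prop;
  points : parity -> model -> Prop;
  smooth_path : (R -> Prop) -> (R -> model) -> Prop
}.

(* [omega x X Y] is the value at [x] on [X], [Y]. Smoothness is the one of
   calculus in Frechet spaces: smooth along smooth curves. *)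
Record is_two_form (M : sign_quotient) (omega : M -> M -> M -> R) : Prop := {
  two_form_plus : forall e x X X' Y,
    points M e x -> tangent M e X -> tangent M e X' -> tangent M e Y ->
    omega x (plus X X') Y = omega x X Y + omega x X' Y;
  two_form_scal : forall e x (a : R) X Y,
    points M e x -> tangent M e X -> tangent M e Y ->
    omega x (scal a X) Y = a * omega x X Y;
  two_form_skew : forall e x X Y,
    points M e x -> tangent M e X -> tangent M e Y ->
    omega x Y X = - omega x X Y;
  two_form_sign : forall e x X Y,
    points M e x -> tangent M e X -> tangent M e Y ->
    omega (opp x) (opp X) (opp Y) = omega x X Y;
  two_form_smooth : forall e (D : R -> Prop) (c X Y : R -> M),
    open D -> smooth_path M D c -> smooth_path M D X -> smooth_path M D Y ->
    (forall s, D s ->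
       points M e (c s) /\ tangent M e (X s) /\ tangent M e (Y s)) ->
    smooth_on (V := R_NormedModule) (W := R_NormedModule) D
      (fun s => omega (c s) (X s) (Y s))
}.

Definition ext_deriv (M : sign_quotient) (omega : M -> M -> M -> R)
    (x X Y Z : M) : R :=
  Derive (fun s => omega (plus x (scal s X)) Y Z) 0
  - Derive (fun s => omega (plus x (scal s Y)) X Z) 0
  + Derive (fun s => omega (plus x (scal s Z)) X Y) 0.

Definition is_closed (M : sign_quotient) (omega : M -> M -> M -> R) : Prop :=
  forall e x X Y Z,
    points M e x -> tangent M e X -> tangent M e Y -> tangent M e Z ->
    ext_deriv M omega x X Y Z = 0.

Definition is_weakly_nondegenerate (M : sign_quotient)
    (omega : M -> M -> M -> R) : Prop :=
  forall e x X, points M e x -> tangent M e X -> X <> zero ->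
    exists Y, tangent M e Y /\ omega x X Y <> 0.

Definition is_weak_symplectic (M : sign_quotient)
    (omega : M -> M -> M -> R) : Prop :=
  is_two_form M omega /\ is_closed M omega /\ is_weakly_nondegenerate M omega.

(** * The loop space and its cotangent bundle *)

Definition varsigma (z : C) : C := (z * z)%C.

Definition smooth_loop (e : parity) (z : R -> C) : Prop :=
  smooth_on (V := R_NormedModule) (W := plane) (fun _ => True) z
  /\ forall tau, z (tau + 1) = match e with Plus => z tau | Minus => Copp (z tau) end.

Definition loop_point (Q : C -> Prop) (e : parity) (z : R -> C) : Prop :=
  smooth_loop e z /\ (forall tau, Q (varsigma (z tau)))
  /\ exists tau, z tau <> RtoC 0.

(* Smooth curves of loops are the jointly smooth maps [(s, tau) |-> c s tau]. *)
Definition smooth_path_of_loops (D : R -> Prop) (c : R -> R -> C) : Prop :=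
  smooth_on (V := R_NormedModule *n R_NormedModule) (W := plane)
    (fun p => D (fst p)) (fun p => c (fst p) (snd p)).

Definition loop_space (Q : C -> Prop) : sign_quotient :=
  {| model := paths;
     tangent := smooth_loop;
     points := loop_point Q;
     smooth_path := smooth_path_of_loops |}.

Definition cotangent (Q : C -> Prop) : sign_quotient :=
  {| model := prod_ModuleSpace R_Ring paths paths;
     tangent := fun e p => smooth_loop e (fst p) /\ smooth_loop e (snd p);
     points := fun e p => loop_point Q e (fst p) /\ smooth_loop e (snd p);
     smooth_path := fun D c => smooth_path_of_loops D (fun s => fst (c s))
                            /\ smooth_path_of_loops D (fun s => snd (c s)) |}.

(** * Twisted-periodic 1-forms *)

(* [theta t q v] is the value of [theta_t] at [q] on the tangent vector [v]. *)
Definition smooth_family_of_one_forms (Q : C -> Prop)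
    (theta : R -> C -> C -> R) : Prop :=
  (forall t q, Q q ->
     is_linear (K := R_AbsRing) (U := plane) (V := R_NormedModule) (theta t q))
  /\ forall v, smooth_on (V := R_NormedModule *n plane) (W := R_NormedModule)
       (fun p => Q (snd p)) (fun p => theta (fst p) (snd p) v).

Definition time_deriv (theta : R -> C -> C -> R) (t : R) (q v : C) : R :=
  Derive (fun s => theta s q v) t.

Definition differential (f : C -> R) (q v : C) : R :=
  Derive (fun s => f (q + RtoC s * v)%C) 0.

Definition twisted_periodic (Q : C -> Prop) (theta : R -> C -> C -> R) : Prop :=
  smooth_family_of_one_forms Q theta
  /\ (forall t q v, Q q -> time_deriv theta (t + 1) q v = time_deriv theta t q v)
  /\ exists f : C -> R,
       smooth_on (V := plane) (W := R_NormedModule) Q f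
       /\ forall t q v, Q q -> theta (t + 1) q v = theta t q v + differential f q v.

(* [d varsigma] at [z] is [v |-> 2 z v]. *)
Definition pullback (theta : R -> C -> C -> R) (t : R) (z v : C) : R :=
  theta t (varsigma z) (RtoC 2 * z * v)%C.

Definition ext_deriv_one_form (alpha : C -> C -> R) (z v w : C) : R :=
  Derive (fun s => alpha (z + RtoC s * v)%C w) 0
  - Derive (fun s => alpha (z + RtoC s * w)%C v) 0.

(** * The forms Sigma and Omega *)

Definition dot (v w : C) : R := fst v * fst w + snd v * snd w.

Definition L2_inner (z w : R -> C) : R := RInt (fun tau => dot (z tau) (w tau)) 0 1.

Definition L2_norm (z : R -> C) : R := sqrt (L2_inner z z).

Definition time_change (z : R -> C) (tau : R) : R :=
  / (L2_norm z) ^ 2 * RInt (fun s => (Cmod (z s)) ^ 2) 0 tau.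

Definition time_change_deriv (z X : R -> C) (tau : R) : R :=
  2 / (L2_norm z) ^ 2 * RInt (fun s => dot (z s) (X s)) 0 tau
  - 2 * L2_inner z X / (L2_norm z) ^ 4 * RInt (fun s => (Cmod (z s)) ^ 2) 0 tau.

Definition Sigma (theta : R -> C -> C -> R) (z X Y : R -> C) : R :=
  let vartheta := pullback theta in
  RInt (fun tau =>
    ext_deriv_one_form (vartheta (time_change z tau)) (z tau) (X tau) (Y tau)
    + time_change_deriv z X tau
      * time_deriv vartheta (time_change z tau) (z tau) (Y tau)
    - time_change_deriv z Y tau
      * time_deriv vartheta (time_change z tau) (z tau) (X tau)) 0 1.

Definition Omega_can (x U V : (R -> C) * (R -> C)) : R :=
  L2_inner (snd U) (fst V) - L2_inner (snd V) (fst U).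

Definition Omega (theta : R -> C -> C -> R) (x U V : (R -> C) * (R -> C)) : R :=
  Omega_can x U V + Sigma theta (fst x) (fst U) (fst V).

(* Main.v *)
Require Import Defs.
From Stdlib Require Import Reals ZArith Lia Lra FunctionalExtensionality ClassicalEpsilon.
From Coquelicot Require Import Coquelicot.
Open Scope R_scope.

(* The magnetic form is exact: [Sigma] is the exterior derivative of the 1-form
   [W |-> int_0^1 vartheta_(t_z)(z) W] on the space of loops, which is invariant
   under the sign involution because [vartheta] is a pull-back under [z |-> z^2].
   Closedness is then the symmetry of second derivatives of this 1-form along
   two-parameter families of loops. Pairing [(X, H)] with [(0, X)], or with
   [(H, 0)] when [X = 0], removes [Sigma] and leaves an L2 norm up to sign. *)

(** * Iterated directional derivatives *)

(** The obstacle is the time change: [time_change z] depends on the whole loop through a quotient of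
    integrals, so the integrand of the 1-form is not a pointwise function of the loop, and every
    differentiation produces new integrals nested inside [theta]. Rather than computing derivatives,
    the proof fixes a class of functions of two parameters and the loop variable, [action_term],
    whose members are continuous and have partial derivatives in the same class. Smoothness along
    curves and symmetry of second derivatives then need no formula; only the first derivative of the
    1-form is computed, to match it with [Sigma]. The two parameters have different roles: [s] runs
    along a curve of loops and [r] displaces the loop along a straight line. Differentiation in [r]
    at [0] builds the exterior derivative; variation of [s] then gives smoothness along curves, or a
    second derivative. The parameter domain has to be open although being a point of the loop space
    is a condition at all times: here compactness of [[0,1]] and 1-periodicity of [varsigma] along a
    loop enter. *)

Lemma continuous_line {V : NormedModule R_AbsRing} (x v : V) (r : R) :
  continuous (fun s : R => plus x (scal s v)) r.
Proof.
apply (continuous_plus (V := V)).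
- apply continuous_const.
- apply (continuous_scal_l (V := V)). apply continuous_id.
Qed.

Lemma locally_line {V : NormedModule R_AbsRing} (D : V -> Prop) (x v : V) :
  open D -> D x -> locally 0 (fun s : R => D (plus x (scal s v))).
Proof.
intros oD Dx.
apply (continuous_line x v 0).
apply oD.
replace (plus x (scal 0 v)) with x; [exact Dx|].
rewrite <- (plus_zero_r x) at 1. f_equal. symmetry. apply (scal_zero_l v).
Qed.

(** Openness of [D] is what makes this work: continuity and directional derivatives at a point of
    [D] look at neighbouring points, and these stay in [D]. *)
Lemma Ck_on_ext {V W : NormedModule R_AbsRing} (D : V -> Prop) (k : nat)
    (f g : V -> W) :
  open D -> (forall x, D x -> f x = g x) -> Ck_on D k f -> Ck_on D k g.
Proof.
intros oD; revert f g; induction k as [|k IH]; intros f g fg Hf.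
- intros x Dx. apply (continuous_ext_loc g f x).
  + apply (filter_imp D); [|exact (oD x Dx)]. intros y Dy; now apply fg.
  + now apply Hf.
- intros v. destruct (Hf v) as [h [h1 h2]]. exists h; split; [|exact h2].
  intros x Dx. apply (is_derive_ext_loc (fun s : R => f (plus x (scal s v)))).
  + apply (filter_imp (fun s : R => D (plus x (scal s v)))).
    * intros s Ds; now apply fg.
    * now apply locally_line.
  + now apply h1.
Qed.

Lemma smooth_on_continuous {V W : NormedModule R_AbsRing} (D : V -> Prop)
    (f : V -> W) x :
  smooth_on D f -> D x -> continuous f x.
Proof. intros H Dx. exact (H O x Dx). Qed.

(** [Ck_on] chooses a derivative separately at each order [k]. By uniqueness of derivatives all
    these choices agree on [D], so the one chosen at order 1 serves for every order. *)
Lemma smooth_on_derive {V : NormedModule R_AbsRing} (D : V -> Prop)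
    (f : V -> R) (v : V) :
  open D -> smooth_on (W := R_NormedModule) D f ->
  exists g : V -> R, smooth_on (W := R_NormedModule) D g /\
    forall x, D x -> is_derive (fun s : R => f (plus x (scal s v))) 0 (g x).
Proof.
intros oD Hf.
destruct (Hf 1%nat v) as [g [g1 _]].
exists g; split; [|exact g1].
intros k. destruct (Hf (S k) v) as [h [h1 h2]].
apply (Ck_on_ext D k h); [exact oD| |exact h2].
intros x Dx.
rewrite <- (is_derive_unique _ _ _ (g1 x Dx)).
symmetry. apply is_derive_unique. now apply h1.
Qed.

Lemma Ck_on_linear {V W W' : NormedModule R_AbsRing} (D : V -> Prop) (k : nat)
    (f : V -> W) (l : W -> W') :
  is_linear l -> Ck_on D k f -> Ck_on D k (fun x => l (f x)).
Proof.
intros hl; revert f; induction k as [|k IH]; intros f Hf.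
- intros x Dx. apply continuous_comp; [now apply Hf|].
  now apply linear_cont.
- intros v. destruct (Hf v) as [g [g1 g2]].
  exists (fun x => l (g x)); split; [|now apply IH].
  intros x Dx.
  apply (filterdiff_ext_lin (U := R_NormedModule) _ (fun y : R => l (scal y (g x)))).
  + apply (filterdiff_comp' (fun s : R => f (plus x (scal s v))) l 0 _ l).
    * now apply g1.
    * now apply filterdiff_linear.
  + intros y. now rewrite linear_scal.
Qed.

Lemma Ck_on_plus {V W : NormedModule R_AbsRing} (D : V -> Prop) (k : nat)
    (f g : V -> W) :
  Ck_on D k f -> Ck_on D k g -> Ck_on D k (fun x => plus (f x) (g x)).
Proof.
revert f g; induction k as [|k IH]; intros f g Hf Hg.
- intros x Dx. apply (continuous_plus (V := W)); auto.
- intros v. destruct (Hf v) as [f' [f1 f2]]. destruct (Hg v) as [g' [g1 g2]].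
  exists (fun x => plus (f' x) (g' x)); split; [|auto].
  intros x Dx.
  apply (is_derive_plus (V := W) (fun s : R => f (plus x (scal s v)))
                        (fun s : R => g (plus x (scal s v)))); auto.
Qed.

(** A linear map sends the line through [x] in direction [v] to the line through [l x] in direction
    [l v], so each directional derivative of the composition is one of [f]. *)
Lemma Ck_on_precomp_linear {V V' W : NormedModule R_AbsRing}
    (D : V' -> Prop) (k : nat) (f : V' -> W) (l : V -> V') :
  is_linear l -> Ck_on D k f ->
  Ck_on (fun x => D (l x)) k (fun x => f (l x)).
Proof.
intros hl; revert f; induction k as [|k IH]; intros f Hf.
- intros x Dx. apply continuous_comp; [|now apply Hf].
  now apply linear_cont.
- intros v. destruct (Hf (l v)) as [g [g1 g2]].
  exists (fun x => g (l x)); split; [|now apply IH].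
  intros x Dx.
  apply (is_derive_ext (fun s : R => f (plus (l x) (scal s (l v))))).
  + intros t. rewrite (linear_plus l hl), (linear_scal l hl). reflexivity.
  + now apply g1.
Qed.

(** A chain rule that peels off one argument: joint continuity is asked of the partial derivative in
    that argument alone, and for the rest only a derivative at [x0] with the argument frozen. In
    this form it can be iterated. *)
Lemma is_derive_comp2 (H Hu : R -> R -> R) (f : R -> R) (x0 d Hx : R) :
  locally (f x0, x0) (fun p : R * R =>
    is_derive (fun u => H u (snd p)) (fst p) (Hu (fst p) (snd p))) ->
  continuous (fun p : R * R => Hu (fst p) (snd p)) (f x0, x0) ->
  is_derive (fun x => H (f x0) x) x0 Hx ->
  is_derive f x0 d ->
  is_derive (fun x => H (f x) x) x0 (d * Hu (f x0) x0 + Hx).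
Proof.
intros h1 h2 h3 h4.
assert (h := is_derive_filterdiff H (f x0) x0 Hu Hx h1 h3 h2).
assert (c := filterdiff_comp'_2 f (fun x : R => x) H x0 _ _
  (fun a b : R => plus (scal a (Hu (f x0) x0)) (scal b Hx)) h4 (is_derive_id x0) h).
simpl in c.
apply (filterdiff_ext_lin _ _ _ c).
intros y. unfold scal, plus; simpl. unfold mult, one; simpl. ring.
Qed.

(** * Smooth functions of time and position *)

Notation spacetime := (R_NormedModule *n plane).

Section SpacetimeFunctions.
Variable Q : C -> Prop.
Hypothesis openQ : open Q.

Definition tube (p : spacetime) : Prop := Q (snd p).

Lemma open_tube : open tube.
Proof.
intros p Qp. apply (continuous_snd (U := R_UniformSpace) (V := C_UniformSpace) (fst p) (snd p)).
now apply openQ.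
Qed.

Definition smooth_st (g : R * C -> R) : Prop :=
  smooth_on (V := spacetime) (W := R_NormedModule) tube g.

Lemma smooth_st_continuous g t a b :
  smooth_st g -> Q (a, b) ->
  continuous (T := spacetime)
    (U := R_UniformSpace) g (t, (a, b)).
Proof. intros sg q. now apply (smooth_on_continuous (V := spacetime) tube g). Qed.

Lemma continuous_triple {T : UniformSpace} (f1 f2 f3 : T -> R) (x : T) :
  continuous f1 x -> continuous f2 x -> continuous f3 x ->
  continuous (U := spacetime)
    (fun y => (f1 y, (f2 y, f3 y))) x.
Proof.
intros h1 h2 h3.
assert (h : continuous (U := prod_UniformSpace R_UniformSpace R_UniformSpace)
  (fun y => (f2 y, f3 y)) x).
{ apply (continuous_comp_2 f2 f3 (fun a b => (a, b)) x h2 h3).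
  apply (continuous_ext (fun p => p)); [now intros []|apply continuous_id]. }
apply (continuous_comp_2 f1 (fun y => (f2 y, f3 y)) (fun a b => (a, b)) x h1 h).
apply (continuous_ext (fun p => p)); [now intros []|apply continuous_id].
Qed.

Lemma smooth_st_comp_continuous {T : UniformSpace} g (f1 f2 f3 : T -> R) (x : T) :
  smooth_st g -> Q (f2 x, f3 x) ->
  continuous f1 x -> continuous f2 x -> continuous f3 x ->
  continuous (fun y => g (f1 y, (f2 y, f3 y))) x.
Proof.
intros sg q h1 h2 h3.
apply (continuous_comp (fun y => (f1 y, (f2 y, f3 y))) g).
- now apply continuous_triple.
- now apply smooth_st_continuous.
Qed.

Lemma is_derive_continuous (f : R -> R) (x l : R) :
  is_derive f x l -> continuous f x.
Proof. intros h. apply (ex_derive_continuous (V := R_NormedModule)). now exists l. Qed.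

(** Turns the directional derivatives of [Ck_on], taken at [0] along a line, into ordinary partial
    derivatives at the point itself. *)
Lemma is_derive_shift (f g : R -> R) (x l : R) :
  (forall s, f (x + s) = g s) -> is_derive g 0 l -> is_derive f x l.
Proof.
intros fg hg.
apply (is_derive_ext (fun u => g (u - x))).
- intros u. rewrite <- fg. f_equal. ring.
- assert (hx : is_derive (fun u => u - x) x 1) by (auto_derive; [easy|ring]).
  assert (h : is_derive g (x - x) l) by now replace (x - x) with 0 by ring.
  assert (hc := is_derive_comp g (fun u => u - x) x l 1 h hx).
  unfold scal in hc; simpl in hc; unfold mult in hc; simpl in hc.
  now rewrite Rmult_1_l in hc.
Qed.

Definition partials_st (g g1 g2 g3 : R * C -> R) : Prop :=
  forall (t a b : R), Q (a, b) ->
    is_derive (fun u => g (u, (a, b))) t (g1 (t, (a, b))) /\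
    is_derive (fun u => g (t, (u, b))) a (g2 (t, (a, b))) /\
    is_derive (fun u => g (t, (a, u))) b (g3 (t, (a, b))).

Lemma smooth_st_partials g :
  smooth_st g -> exists g1 g2 g3,
    smooth_st g1 /\ smooth_st g2 /\ smooth_st g3 /\ partials_st g g1 g2 g3.
Proof.
intros sg.
destruct (smooth_on_derive (V := spacetime) tube g (1, (0, 0)) open_tube sg) as [g1 [s1 h1]].
destruct (smooth_on_derive (V := spacetime) tube g (0, (1, 0)) open_tube sg) as [g2 [s2 h2]].
destruct (smooth_on_derive (V := spacetime) tube g (0, (0, 1)) open_tube sg) as [g3 [s3 h3]].
exists g1, g2, g3. do 3 (split; [assumption|]).
intros t a b q. split; [|split].
- refine (is_derive_shift (fun u => g (u, (a, b))) _ t _ _ (h1 (t, (a, b)) q)).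
  intros s. f_equal. cbv -[Rplus Rmult]. repeat f_equal; ring.
- refine (is_derive_shift (fun u => g (t, (u, b))) _ a _ _ (h2 (t, (a, b)) q)).
  intros s. f_equal. cbv -[Rplus Rmult]. repeat f_equal; ring.
- refine (is_derive_shift (fun u => g (t, (a, u))) _ b _ _ (h3 (t, (a, b)) q)).
  intros s. f_equal. cbv -[Rplus Rmult]. repeat f_equal; ring.
Qed.

(** Two applications of [is_derive_comp2] remove the first and second arguments, which uses
    continuity of [g1] and [g2]; the third is left to the one-variable chain rule. *)
Lemma is_derive_comp_st g g1 g2 g3 (f1 f2 f3 : R -> R) (x d1 d2 d3 : R) :
  smooth_st g1 -> smooth_st g2 -> partials_st g g1 g2 g3 ->
  Q (f2 x, f3 x) ->
  is_derive f1 x d1 -> is_derive f2 x d2 -> is_derive f3 x d3 ->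
  is_derive (fun y => g (f1 y, (f2 y, f3 y))) x
    (d1 * g1 (f1 x, (f2 x, f3 x)) + d2 * g2 (f1 x, (f2 x, f3 x))
     + d3 * g3 (f1 x, (f2 x, f3 x))).
Proof.
intros s1 s2 pg q h1 h2 h3.
assert (cf2 : continuous f2 x) by (eapply is_derive_continuous; eauto).
assert (cf3 : continuous f3 x) by (eapply is_derive_continuous; eauto).
assert (near : forall (k1 k2 : R * R -> R) (p : R * R), Q (k1 p, k2 p) ->
  continuous k1 p -> continuous k2 p -> locally p (fun p' => Q (k1 p', k2 p'))).
{ intros k1 k2 p qp c1 c2.
  (* The time coordinate is a dummy: openness of the tube only concerns the position. *)
  assert (c := continuous_triple (fun _ => 0) k1 k2 p (continuous_const 0 p) c1 c2).
  apply (c (fun p' => Q (snd p'))). now apply open_tube. }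
assert (cfst : forall p : R * R, continuous (fun p => fst p) p) by (intros []; apply continuous_fst).
assert (csnd : forall p : R * R, continuous (fun p => snd p) p) by (intros []; apply continuous_snd).
rewrite Rplus_assoc.
apply (is_derive_comp2 (fun u y => g (u, (f2 y, f3 y))) (fun u y => g1 (u, (f2 y, f3 y)))).
- apply (filter_imp (fun p : R * R => Q (f2 (snd p), f3 (snd p)))).
  + intros p qp. now apply pg.
  + apply (near (fun p => f2 (snd p)) (fun p => f3 (snd p))); [exact q| |];
    now apply continuous_comp.
- apply (smooth_st_comp_continuous g1 (fun p : R * R => fst p)
    (fun p => f2 (snd p)) (fun p => f3 (snd p)));
    [exact s1|exact q|apply cfst| |]; now apply continuous_comp.
- apply (is_derive_comp2 (fun u y => g (f1 x, (u, f3 y))) (fun u y => g2 (f1 x, (u, f3 y)))).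
  + apply (filter_imp (fun p : R * R => Q (fst p, f3 (snd p)))).
    * intros p qp. now apply pg.
    * apply (near (fun p => fst p) (fun p => f3 (snd p))); [exact q|apply cfst|].
      now apply continuous_comp.
  + apply (smooth_st_comp_continuous g2 (fun p : R * R => f1 x)
      (fun p => fst p) (fun p => f3 (snd p)));
      [exact s2|exact q|apply continuous_const|apply cfst|now apply continuous_comp].
  + apply (is_derive_comp (fun u => g (f1 x, (f2 x, u))) f3); [|exact h3].
    now apply pg.
  + exact h2.
- exact h1.
Qed.
End SpacetimeFunctions.
(** * Parametrized integrals *)

(** Compactness of [[a,b]]: a neighbourhood of the segment over [x] contains a product
    neighbourhood. It yields both uniform estimates for integrals and openness of conditions imposed
    at all times of a loop. *)
Lemma tube_lemma {T : UniformSpace} (x : T) (P : T -> R -> Prop) (a b : R) :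
  (forall t, a <= t <= b ->
    locally (T := prod_UniformSpace T R_UniformSpace) (x, t)
      (fun p => P (fst p) (snd p))) ->
  locally x (fun y => forall t, a <= t <= b -> P y t).
Proof.
intros H.
(* The gauge for the compactness theorem must be defined on all of [R]; outside [[a,b]] the radius 1
   is a default without meaning. *)
assert (H' : forall t, exists eps : posreal, a <= t <= b -> forall y u,
  ball x eps y -> Rabs (u - t) < eps -> P y u).
{ intros t. destruct (excluded_middle_informative (a <= t <= b)) as [ht|ht].
  - destruct (H t ht) as [eps heps]. exists eps. intros _ y u hy hu.
    apply (heps (y, u)). split; [exact hy|exact hu].
  - exists (mkposreal 1 Rlt_0_1). intros ht'. contradiction. }
pose (delta := fun t => proj1_sig (constructive_indefinite_description _ (H' t))).
assert (hd : forall t, a <= t <= b -> forall y u,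
  ball x (delta t) y -> Rabs (u - t) < delta t -> P y u).
{ intros t. unfold delta. now destruct constructive_indefinite_description. }
destruct (compactness_value_1d a b delta) as [d hdd].
exists d. intros y hy t ht.
(* The compactness theorem gives its centre [u] only under a double negation, so the goal is proved
   by contradiction. *)
apply Classical_Prop.NNPP. intros nP. apply (hdd t ht). intros [u [hu [h1 h2]]].
apply nP. apply (hd u hu); [|exact h1].
now apply ball_le with d.
Qed.

Lemma continuous_pair_l {T1 T2 : UniformSpace} (f : T1 * T2 -> R) (x : T1) (t : T2) :
  continuous f (x, t) -> continuous (fun y => f (y, t)) x.
Proof.
intros h. apply (continuous_comp (fun y => (y, t)) f); [|exact h].
apply (continuous_comp_2 (fun y : T1 => y) (fun _ : T1 => t) (fun a b => (a, b)));
  [apply continuous_id|apply continuous_const|].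
apply (continuous_ext (fun p => p)); [now intros []|apply continuous_id].
Qed.

Lemma continuous_pair_r {T1 T2 : UniformSpace} (f : T1 * T2 -> R) (x : T1) (t : T2) :
  continuous f (x, t) -> continuous (fun u => f (x, u)) t.
Proof.
intros h. apply (continuous_comp (fun u => (x, u)) f); [|exact h].
apply (continuous_comp_2 (fun _ : T2 => x) (fun u : T2 => u) (fun a b => (a, b)));
  [apply continuous_const|apply continuous_id|].
apply (continuous_ext (fun p => p)); [now intros []|apply continuous_id].
Qed.

Lemma ex_RInt_of_continuous (f : R -> R) a b :
  (forall t, continuous f t) -> ex_RInt f a b.
Proof. intros h. apply (ex_RInt_continuous (V := R_CompleteNormedModule)); auto. Qed.

Lemma is_derive_primitive (f : R -> R) (u : R) :
  (forall t, continuous f t) -> is_derive (fun v => RInt f 0 v) u (f u).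
Proof.
intros h. apply (is_derive_RInt f (fun v => RInt f 0 v) 0); [|apply h].
apply filter_forall. intros v.
apply (RInt_correct (V := R_CompleteNormedModule)). now apply ex_RInt_of_continuous.
Qed.

(** The difference of two values splits into the effect of the parameter at a fixed upper limit,
    small by uniform closeness on a compact interval, and the effect of the upper limit at the fixed
    parameter [x], small by continuity of a primitive. *)
Lemma continuous_primitive {T : UniformSpace} (f : T * R -> R) (U : T -> Prop)
    (x : T) (t : R) :
  open U -> U x -> (forall y u, U y -> continuous f (y, u)) ->
  continuous (fun p : T * R => RInt (fun u => f (fst p, u)) 0 (snd p)) (x, t).
Proof.
intros oU Ux cf.
assert (cx : forall y, U y -> forall u, continuous (fun u => f (y, u)) u).
{ intros y Uy u. apply continuous_pair_r. auto. }
apply filterlim_locally. intros eps.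
(* Every upper limit [v] at distance less than 1 from [t] satisfies [Rabs v <= M]. *)
pose (M := Rabs t + 1).
assert (hM : 0 < M) by (unfold M; pose proof (Rabs_pos t); lra).
assert (he : 0 < eps / (2 * M)).
{ apply Rdiv_lt_0_compat; [apply cond_pos|lra]. }
assert (h1 : locally x (fun y => forall u, - M <= u <= M ->
  Rabs (f (y, u) - f (x, u)) < eps / (2 * M))).
{ apply tube_lemma. intros u _.
  assert (he' : 0 < eps / (2 * M) / 2) by lra.
  assert (c1 := proj1 (filterlim_locally _ _) (cf x u Ux) (mkposreal _ he')).
  assert (c2 : continuous (fun p : T * R => f (x, snd p)) (x, u)).
  { apply (continuous_comp (fun p : T * R => snd p) (fun v => f (x, v))).
    - apply continuous_snd.
    - now apply cx. }
  assert (c2' := proj1 (filterlim_locally _ _) c2 (mkposreal _ he')).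
  generalize (filter_and _ _ c1 c2'). apply filter_imp.
  intros [y v] [b1 b2]. simpl.
  assert (b1' : Rabs (f (@pair T R y v) - f (x, u)) < eps / (2 * M) / 2) by exact b1.
  assert (b2' : Rabs (f (@pair T R x v) - f (x, u)) < eps / (2 * M) / 2) by exact b2.
  apply Rabs_def2 in b1' as [m1 m2]. apply Rabs_def2 in b2' as [m3 m4].
  apply Rabs_def1; lra. }
assert (h2 : locally t (fun v => Rabs (RInt (fun u => f (x, u)) 0 v
   - RInt (fun u => f (x, u)) 0 t) < eps / 2)).
{ assert (he' : 0 < eps / 2) by (pose proof (cond_pos eps); lra).
  exact (proj1 (filterlim_locally _ _)
    (is_derive_continuous _ _ _ (is_derive_primitive (fun u => f (x, u)) t (cx x Ux)))
    (mkposreal _ he')). }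
assert (h3 : locally t (fun v => Rabs (v - t) < 1)).
{ now exists (mkposreal 1 Rlt_0_1). }
assert (h4 := filter_and _ _ h1 (oU x Ux)).
assert (h5 := filter_and _ _ h2 h3).
destruct h4 as [d1 h4]. destruct h5 as [d2 h5].
assert (hd : 0 < Rmin d1 d2) by (apply Rmin_pos; apply cond_pos).
exists (mkposreal _ hd). intros [y v] [by1 bv]. simpl in by1, bv |- *.
destruct (h4 y) as [k1 Uy]; [apply ball_le with (2 := by1); apply Rmin_l|].
destruct (h5 v) as [k2 k3]; [apply ball_le with (2 := bv); apply Rmin_r|].
change (Rabs (RInt (fun u => f (y, u)) 0 v - RInt (fun u => f (x, u)) 0 t) < eps).
assert (hv : Rabs v <= M).
{ unfold M. replace v with ((v - t) + t) by ring.
  eapply Rle_trans; [apply Rabs_triang|]. lra. }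
(* The mean value inequality for the difference of the two primitives avoids a case distinction on
   the sign of [v]. It asks for the bound at all [w] with [Rabs w <= Rabs v], hence the symmetric
   interval in [h1]. *)
assert (k4 := bounded_variation
  (fun w => RInt (fun u => f (y, u)) 0 w - RInt (fun u => f (x, u)) 0 w)
  (fun w => f (y, w) - f (x, w)) (eps / (2 * M)) 0 v).
cbv beta in k4. rewrite !RInt_point in k4.
match type of k4 with _ -> ?A => assert (k5 : A) end.
{ apply k4. intros w hw. split.
  - apply (is_derive_minus (V := R_NormedModule)); now apply is_derive_primitive, cx.
  - apply Rlt_le, k1. rewrite !Rminus_0_r in hw.
    assert (hw' : Rabs w <= M) by lra. now apply Rabs_le_between in hw'. }
assert (k6 : eps / (2 * M) * Rabs (v - 0) <= eps / 2).
{ rewrite Rminus_0_r. apply Rle_trans with (eps / (2 * M) * M).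
  - apply Rmult_le_compat_l; lra.
  - right. field. lra. }
change (zero : R) with 0 in k5.
rewrite Rminus_0_r, Rminus_0_r in k5.
replace (RInt (fun u => f (y, u)) 0 v - RInt (fun u => f (x, u)) 0 t) with
  ((RInt (fun u => f (y, u)) 0 v - RInt (fun u => f (x, u)) 0 v)
   + (RInt (fun u => f (x, u)) 0 v - RInt (fun u => f (x, u)) 0 t)) by ring.
eapply Rle_lt_trans; [apply Rabs_triang|]. lra.
Qed.

Lemma is_derive_primitive_param (k kx : R -> R -> R) (x b : R) :
  locally x (fun y => forall t, is_derive (fun z => k z t) y (kx y t)) ->
  locally x (fun y => forall t, continuous (k y) t) ->
  (forall t, continuous (fun p : R * R => kx (fst p) (snd p)) (x, t)) ->
  is_derive (fun y => RInt (k y) 0 b) x (RInt (kx x) 0 b).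
Proof.
intros h1 h2 h3.
replace (RInt (kx x) 0 b) with (RInt (fun t => Derive (fun z => k z t) x) 0 b).
- apply is_derive_RInt_param.
  + generalize h1. apply filter_imp. intros y hy t _. now exists (kx y t).
  + intros t _. apply continuity_2d_pt_filterlim.
    apply (continuous_ext_loc (fun p : R * R => Derive (fun z => k z (snd p)) (fst p))
      (fun p : R * R => kx (fst p) (snd p)) (x, t)); [|apply h3].
    destruct h1 as [d hd]. exists d. intros [y u] [hy _]. simpl.
    symmetry. apply is_derive_unique. now apply hd.
  + generalize h2. apply filter_imp. intros y hy. now apply ex_RInt_of_continuous.
- apply RInt_ext. intros t _. apply is_derive_unique.
  apply (locally_singleton _ _ h1).
Qed.

(** * A class of parametrized integrals closed under differentiation *)

Section ParametrizedIntegrals.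
Variables (Q : C -> Prop) (D : R -> Prop) (U : R * R -> Prop).
Hypotheses (openQ : open Q) (openD : open D) (openU : open U)
  (subUD : forall s r, U (s, r) -> D s).

Definition smooth_sheet (h : R * R -> R) : Prop :=
  smooth_on (V := R_NormedModule *n R_NormedModule) (W := R_NormedModule)
    (fun p => D (fst p)) h.

(* Functions of [((s, r), t)], with parameters [(s, r)] in [U] and loop variable [t].
   The constructors are chosen so that the class contains the action of a
   two-parameter family of loops and is closed under partial derivatives. *)
Inductive action_term : ((R * R) * R -> R) -> Prop :=
| term_sheet h : smooth_sheet h -> action_term (fun p => h (fst (fst p), snd p))
| term_param : action_term (fun p => snd (fst p))
| term_const a : action_term (fun _ => a)
| term_plus f g : action_term f -> action_term g -> action_term (fun p => f p + g p)
| term_mult f g : action_term f -> action_term g -> action_term (fun p => f p * g p)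
| term_inv f : action_term f -> (forall x t, U x -> f (x, t) <> 0) ->
    action_term (fun p => / f p)
| term_primitive f : action_term f ->
    action_term (fun p => RInt (fun t => f (fst p, t)) 0 (snd p))
| term_end f : action_term f -> action_term (fun p => f (fst p, 1))
| term_comp g f1 f2 f3 : smooth_st Q g ->
    action_term f1 -> action_term f2 -> action_term f3 ->
    (forall x t, U x -> Q (f2 (x, t), f3 (x, t))) ->
    action_term (fun p => g (f1 p, (f2 p, f3 p))).

Lemma action_term_continuous f x t : action_term f -> U x -> continuous f (x, t).
Proof.
intros Ef. revert x t.
induction Ef as [h sh| |a|f g _ IHf _ IHg|f g _ IHf _ IHg|f _ IHf nz|f _ IHf
  |f _ IHf|g f1 f2 f3 sg _ IH1 _ IH2 _ IH3 q]; intros x t Ux.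
- apply (continuous_comp (fun p : R * R * R => (fst (fst p), snd p)) h).
  + apply (continuous_comp_2 (fun p : R * R * R => fst (fst p)) (fun p : R * R * R => snd p)
      (fun a b => (a, b))).
    * apply (continuous_comp (fun p : R * R * R => fst p) (fun p : R * R => fst p)).
      -- apply continuous_fst.
      -- destruct x; apply continuous_fst.
    * apply continuous_snd.
    * apply (continuous_ext (fun p => p)); [now intros []|apply continuous_id].
  + apply (smooth_on_continuous (V := R_NormedModule *n R_NormedModule) _ h _ sh).
    destruct x as [s r]. exact (subUD s r Ux).
- apply (continuous_comp (fun p : R * R * R => fst p) (fun p : R * R => snd p)).
  + apply continuous_fst.
  + destruct x; apply continuous_snd.
- apply continuous_const.
- apply (continuous_plus (V := R_NormedModule)); auto.
- apply (continuous_mult (K := R_AbsRing)); auto.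
- apply (continuous_comp f (fun v => / v)); [auto|now apply continuous_Rinv, nz].
- apply (continuous_primitive f U); auto.
- apply (continuous_comp (fun p : R * R * R => fst p) (fun y => f (y, 1))).
  + apply continuous_fst.
  + apply continuous_pair_l. auto.
- apply (smooth_st_comp_continuous Q); auto.
Qed.

Definition partials (f fs fr ft : (R * R) * R -> R) : Prop :=
  forall s r t : R, U (s, r) ->
    is_derive (fun u => f ((u, r), t)) s (fs ((s, r), t)) /\
    is_derive (fun u => f ((s, u), t)) r (fr ((s, r), t)) /\
    is_derive (fun u => f ((s, r), u)) t (ft ((s, r), t)).

Lemma locally_U_l s r : U (s, r) -> locally s (fun u => U (u, r)).
Proof.
intros h. destruct (openU _ h) as [d hd]. exists d. intros u hu.
apply hd. split; [exact hu|apply ball_center].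
Qed.

Lemma locally_U_r s r : U (s, r) -> locally r (fun u => U (s, u)).
Proof.
intros h. destruct (openU _ h) as [d hd]. exists d. intros u hu.
apply hd. split; [apply ball_center|exact hu].
Qed.

Lemma continuous_pair_slice_l (f : R * R * R -> R) s r t :
  continuous f ((s, r), t) ->
  continuous (fun p : R * R => f ((fst p, r), snd p)) (s, t).
Proof.
intros h. apply (continuous_comp (fun p : R * R => ((fst p, r), snd p)) f); [|exact h].
intros P [d hd]. exists d. intros [a b] [ha hb]. apply hd.
split; [split; [exact ha|apply ball_center]|exact hb].
Qed.

Lemma continuous_pair_slice_r (f : R * R * R -> R) s r t :
  continuous f ((s, r), t) ->
  continuous (fun p : R * R => f ((s, fst p), snd p)) (r, t).
Proof.
intros h. apply (continuous_comp (fun p : R * R => ((s, fst p), snd p)) f); [|exact h].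
intros P [d hd]. exists d. intros [a b] [ha hb]. apply hd.
split; [split; [apply ball_center|exact ha]|exact hb].
Qed.

Lemma smooth_sheet_partials h : smooth_sheet h ->
  exists h1 h2, smooth_sheet h1 /\ smooth_sheet h2 /\
    forall s t : R, D s ->
      is_derive (fun u => h (u, t)) s (h1 (s, t)) /\
      is_derive (fun u => h (s, u)) t (h2 (s, t)).
Proof.
intros sh.
assert (oD : open (fun p : R_NormedModule *n R_NormedModule => D (fst p))).
{ intros [s t] Ds. apply (continuous_fst (U := R_UniformSpace) (V := R_UniformSpace) s t).
  now apply openD. }
destruct (smooth_on_derive (V := R_NormedModule *n R_NormedModule) _ h (1, 0) oD sh) as [h1 [s1 k1]].
destruct (smooth_on_derive (V := R_NormedModule *n R_NormedModule) _ h (0, 1) oD sh) as [h2 [s2 k2]].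
exists h1, h2. do 2 (split; [assumption|]).
intros s t Ds. split.
- refine (is_derive_shift (fun u => h (u, t)) _ s _ _ (k1 (s, t) Ds)).
  intros v. f_equal. cbv -[Rplus Rmult]. repeat f_equal; ring.
- refine (is_derive_shift (fun u => h (s, u)) _ t _ _ (k2 (s, t) Ds)).
  intros v. f_equal. cbv -[Rplus Rmult]. repeat f_equal; ring.
Qed.

(** The closure property for which the constructors were chosen. Parameter derivatives of a
    primitive pass under the integral, while its [t]-derivative is the integrand itself. Iterated,
    it gives continuous partial derivatives of every order. *)
Lemma action_term_partials f : action_term f ->
  exists fs fr ft, action_term fs /\ action_term fr /\ action_term ft /\
    partials f fs fr ft.
Proof.
intros Ef.
induction Ef as [h sh| |a|f g Ef IHf Eg IHg|f g Ef IHf Eg IHg|f Ef IHf nz|f Ef IHf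
  |f Ef IHf|g f1 f2 f3 sg E1 IH1 E2 IH2 E3 IH3 q].
- destruct (smooth_sheet_partials h sh) as [h1 [h2 [s1 [s2 k]]]].
  exists (fun p => h1 (fst (fst p), snd p)), (fun _ => 0), (fun p => h2 (fst (fst p), snd p)).
  do 3 (split; [now constructor|]). intros s r t Us; simpl.
  destruct (k s t (subUD s r Us)) as [k1 k2].
  split; [exact k1|split; [|exact k2]].
  apply (is_derive_const (V := R_NormedModule)).
- exists (fun _ => 0), (fun _ => 1), (fun _ => 0).
  do 3 (split; [constructor|]). intros s r t Us; simpl.
  split; [|split]; try apply (is_derive_const (V := R_NormedModule)).
  apply (is_derive_id (K := R_AbsRing)).
- exists (fun _ => 0), (fun _ => 0), (fun _ => 0).
  do 3 (split; [constructor|]). intros s r t Us; simpl.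
  split; [|split]; apply (is_derive_const (V := R_NormedModule)).
- destruct IHf as [fs [fr [ft [h1 [h2 [h3 hf]]]]]].
  destruct IHg as [gs [gr [gt [k1 [k2 [k3 hg]]]]]].
  exists (fun p => fs p + gs p), (fun p => fr p + gr p), (fun p => ft p + gt p).
  do 3 (split; [now constructor|]). intros s r t Us.
  destruct (hf s r t Us) as [l1 [l2 l3]]. destruct (hg s r t Us) as [m1 [m2 m3]].
  split; [|split]; now apply (is_derive_plus (V := R_NormedModule)).
- destruct IHf as [fs [fr [ft [h1 [h2 [h3 hf]]]]]].
  destruct IHg as [gs [gr [gt [k1 [k2 [k3 hg]]]]]].
  exists (fun p => fs p * g p + f p * gs p), (fun p => fr p * g p + f p * gr p),
    (fun p => ft p * g p + f p * gt p).
  do 3 (split; [now apply term_plus; apply term_mult|]). intros s r t Us.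
  destruct (hf s r t Us) as [l1 [l2 l3]]. destruct (hg s r t Us) as [m1 [m2 m3]].
  split; [|split]; apply (is_derive_mult (K := R_AbsRing)); auto; exact Rmult_comm.
- destruct IHf as [fs [fr [ft [h1 [h2 [h3 hf]]]]]].
  (* The derivative of the inverse is written as a product, because the class has constructors for
     products and inverses but none for quotients or powers. *)
  assert (E : forall h, action_term h -> action_term (fun p => - 1 * h p * (/ f p * / f p))).
  { intros h Eh. repeat apply term_mult; auto using term_const, term_inv. }
  exists (fun p => - 1 * fs p * (/ f p * / f p)), (fun p => - 1 * fr p * (/ f p * / f p)),
    (fun p => - 1 * ft p * (/ f p * / f p)).
  do 3 (split; [now apply E|]). intros s r t Us.
  destruct (hf s r t Us) as [l1 [l2 l3]].
  assert (e : forall a, - 1 * a * (/ f (s, r, t) * / f (s, r, t)) = - a / f (s, r, t) ^ 2).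
  { intros a. field. now apply nz. }
  rewrite !e. split; [|split].
  + now apply (is_derive_inv (fun u => f ((u, r), t))); [|apply nz].
  + now apply (is_derive_inv (fun u => f ((s, u), t))); [|apply nz].
  + now apply (is_derive_inv (fun u => f ((s, r), u))); [|apply nz].
- destruct IHf as [fs [fr [ft [h1 [h2 [h3 hf]]]]]].
  exists (fun p => RInt (fun t => fs (fst p, t)) 0 (snd p)),
    (fun p => RInt (fun t => fr (fst p, t)) 0 (snd p)), f.
  do 2 (split; [now apply term_primitive|]). split; [exact Ef|]. intros s r t Us; simpl.
  split; [|split].
  + apply (is_derive_primitive_param (fun u v => f ((u, r), v)) (fun u v => fs ((u, r), v))).
    * generalize (locally_U_l s r Us). apply filter_imp. intros u Uu v.
      now apply hf.
    * generalize (locally_U_l s r Us). apply filter_imp. intros u Uu v.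
      apply continuous_pair_r. now apply action_term_continuous.
    * intros v. apply continuous_pair_slice_l. now apply action_term_continuous.
  + apply (is_derive_primitive_param (fun u v => f ((s, u), v)) (fun u v => fr ((s, u), v))).
    * generalize (locally_U_r s r Us). apply filter_imp. intros u Uu v.
      now apply hf.
    * generalize (locally_U_r s r Us). apply filter_imp. intros u Uu v.
      apply continuous_pair_r. now apply action_term_continuous.
    * intros v. apply continuous_pair_slice_r. now apply action_term_continuous.
  + apply (is_derive_primitive (fun v => f ((s, r), v))). intros v.
    apply continuous_pair_r. now apply action_term_continuous.
- destruct IHf as [fs [fr [ft [h1 [h2 [h3 hf]]]]]].
  exists (fun p => fs (fst p, 1)), (fun p => fr (fst p, 1)), (fun _ => 0).
  do 2 (split; [now apply term_end|]). split; [constructor|]. intros s r t Us; simpl.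
  destruct (hf s r 1 Us) as [l1 [l2 l3]].
  split; [|split]; auto. apply (is_derive_const (V := R_NormedModule)).
- destruct IH1 as [f1s [f1r [f1t [p1 [p2 [p3 hf1]]]]]].
  destruct IH2 as [f2s [f2r [f2t [q1 [q2 [q3 hf2]]]]]].
  destruct IH3 as [f3s [f3r [f3t [r1 [r2 [r3 hf3]]]]]].
  destruct (smooth_st_partials Q openQ g sg) as [g1 [g2 [g3 [s1 [s2 [s3 pg]]]]]].
  assert (E : forall k1 k2 k3, action_term k1 -> action_term k2 -> action_term k3 ->
    action_term (fun p => k1 p * g1 (f1 p, (f2 p, f3 p)) + k2 p * g2 (f1 p, (f2 p, f3 p))
      + k3 p * g3 (f1 p, (f2 p, f3 p)))).
  { intros k1 k2 k3 e1 e2 e3.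
    repeat apply term_plus; apply term_mult; auto; now apply term_comp. }
  exists (fun p => f1s p * g1 (f1 p, (f2 p, f3 p)) + f2s p * g2 (f1 p, (f2 p, f3 p))
      + f3s p * g3 (f1 p, (f2 p, f3 p))),
    (fun p => f1r p * g1 (f1 p, (f2 p, f3 p)) + f2r p * g2 (f1 p, (f2 p, f3 p))
      + f3r p * g3 (f1 p, (f2 p, f3 p))),
    (fun p => f1t p * g1 (f1 p, (f2 p, f3 p)) + f2t p * g2 (f1 p, (f2 p, f3 p))
      + f3t p * g3 (f1 p, (f2 p, f3 p))).
  do 3 (split; [now apply E|]). intros s r t Us.
  destruct (hf1 s r t Us) as [a1 [a2 a3]]. destruct (hf2 s r t Us) as [b1 [b2 b3]].
  destruct (hf3 s r t Us) as [c1 [c2 c3]].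
  split; [|split].
  + apply (is_derive_comp_st Q openQ g g1 g2 g3 (fun u => f1 ((u, r), t))
      (fun u => f2 ((u, r), t)) (fun u => f3 ((u, r), t))); auto.
  + apply (is_derive_comp_st Q openQ g g1 g2 g3 (fun u => f1 ((s, u), t))
      (fun u => f2 ((s, u), t)) (fun u => f3 ((s, u), t))); auto.
  + apply (is_derive_comp_st Q openQ g g1 g2 g3 (fun u => f1 ((s, r), u))
      (fun u => f2 ((s, r), u)) (fun u => f3 ((s, r), u))); auto.
Qed.

(** Both mixed derivatives are values of terms on the open set [U], hence continuous, which is what
    the theorem of Schwarz requires. The loop variable is frozen at [1], where a primitive becomes
    the integral over the period. *)
Lemma action_term_schwarz f s r : action_term f -> U (s, r) ->
  Derive (fun u => Derive (fun v => f ((u, v), 1)) r) s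
  = Derive (fun v => Derive (fun u => f ((u, v), 1)) s) r.
Proof.
intros Ef Us.
destruct (action_term_partials f Ef) as [fs [fr [ft [Es [Er [Et hf]]]]]].
destruct (action_term_partials fs Es) as [fss [fsr [fst' [Ess [Esr [Est hfs]]]]]].
destruct (action_term_partials fr Er) as [frs [frr [frt [Ers [Err [Ert hfr]]]]]].
assert (d1 : forall u v, U (u, v) -> Derive (fun z => f ((z, v), 1)) u = fs ((u, v), 1)).
{ intros u v Uu. apply is_derive_unique. now apply hf. }
assert (d2 : forall u v, U (u, v) -> Derive (fun z => f ((u, z), 1)) v = fr ((u, v), 1)).
{ intros u v Uu. apply is_derive_unique. now apply hf. }
assert (e1 : forall u v, U (u, v) ->
  is_derive (fun z => Derive (fun w => f ((u, w), 1)) z) v (frr ((u, v), 1)) /\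
  is_derive (fun z => Derive (fun w => f ((z, w), 1)) v) u (frs ((u, v), 1)) /\
  is_derive (fun z => Derive (fun w => f ((w, z), 1)) u) v (fsr ((u, v), 1))).
{ intros u v Uu. split; [|split].
  - apply (is_derive_ext_loc (fun z => fr ((u, z), 1))); [|now apply hfr].
    generalize (locally_U_r u v Uu). apply filter_imp. intros z Uz. now rewrite d2.
  - apply (is_derive_ext_loc (fun z => fr ((z, v), 1))); [|now apply hfr].
    generalize (locally_U_l u v Uu). apply filter_imp. intros z Uz. now rewrite d2.
  - apply (is_derive_ext_loc (fun z => fs ((u, z), 1))); [|now apply hfs].
    generalize (locally_U_r u v Uu). apply filter_imp. intros z Uz. now rewrite d1. }
assert (loc : locally (s, r) U) by now apply openU.
apply Schwarz.
- apply locally_2d_locally. generalize loc. apply filter_imp. intros [u v] Uu; simpl.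
  destruct (e1 u v Uu) as [g1 [g2 g3]]. destruct (hf u v 1 Uu) as [k1 [k2 _]].
  split; [|split; [|split]]; eexists; eassumption.
- apply continuity_2d_pt_filterlim.
  apply (continuous_ext_loc (fun p : R * R =>
    Derive (fun z => Derive (fun w => f ((z, w), 1)) (snd p)) (fst p))
    (fun p => frs (p, 1)) (s, r)).
  + generalize loc. apply filter_imp. intros [u v] Uu; simpl.
    symmetry. apply is_derive_unique. now apply e1.
  + apply continuous_pair_l. now apply action_term_continuous.
- apply continuity_2d_pt_filterlim.
  apply (continuous_ext_loc (fun p : R * R =>
    Derive (fun z => Derive (fun w => f ((w, z), 1)) (fst p)) (snd p))
    (fun p => fsr (p, 1)) (s, r)).
  + generalize loc. apply filter_imp. intros [u v] Uu; simpl.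
    symmetry. apply is_derive_unique. now apply e1.
  + apply continuous_pair_l. now apply action_term_continuous.
Qed.

Lemma action_term_smooth f : action_term f -> (forall s, D s -> U (s, 0)) ->
  smooth_on (V := R_NormedModule) (W := R_NormedModule) D (fun s => f ((s, 0), 1)).
Proof.
intros Ef DU k. revert f Ef. induction k as [|k IH]; intros f Ef.
- intros s Ds. apply (continuous_comp (fun u : R => (u, 0)) (fun x => f (x, 1))).
  + apply (continuous_comp_2 (fun u : R => u) (fun _ : R => 0) (fun a b => (a, b)));
      [apply continuous_id|apply continuous_const|].
    apply (continuous_ext (fun p => p)); [now intros []|apply continuous_id].
  + apply continuous_pair_l. apply action_term_continuous; auto.
- intros v.
  destruct (action_term_partials f Ef) as [fs [fr [ft [Es [Er [Et hf]]]]]].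
  (* The derivative in direction [v] is [v] times the ordinary one, and [v * fs] is again a term, so
     the induction hypothesis applies to it. *)
  exists (fun s => v * fs ((s, 0), 1)). split.
  + intros s Ds.
    assert (h : forall a b : R, is_derive (fun u => a + u * b) 0 b)
      by (intros; auto_derive; [easy|ring]).
    assert (e : forall a b : R, a + 0 * b = a) by (intros; ring).
    apply (is_derive_comp (fun u => f ((u, 0), 1)) (fun u => s + u * v) 0 _ v); [|apply h].
    rewrite e. apply hf; auto.
  + apply (IH (fun p => v * fs p)). apply term_mult; [constructor|exact Es].
Qed.
End ParametrizedIntegrals.

(** * Loops *)

(* Convertible to [plus z (scal r X)] in [paths]. *)
Definition shift (z X : R -> C) (r : R) : R -> C :=
  fun t => (fst (z t) + r * fst (X t), snd (z t) + r * snd (X t)).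

Lemma is_linear_re : is_linear (U := plane) (V := R_NormedModule) (fun z : C => fst z).
Proof. apply (is_linear_fst (K := R_AbsRing) (U := R_NormedModule) (V := R_NormedModule)). Qed.

Lemma is_linear_im : is_linear (U := plane) (V := R_NormedModule) (fun z : C => snd z).
Proof. apply (is_linear_snd (K := R_AbsRing) (U := R_NormedModule) (V := R_NormedModule)). Qed.

(** Reduces conditions at all times to the compact interval [[0,1]]. It is applied to [varsigma] and
    to the squared modulus along a loop, which are 1-periodic for both parities. *)
Lemma periodic_unit_interval {T : Type} (h : R -> T) (t : R) :
  (forall u, h (u + 1) = h u) -> exists u, 0 <= u <= 1 /\ h u = h t.
Proof.
intros per.
assert (pn : forall n u, h (u + INR n) = h u).
{ induction n as [|n IH]; intros u.
  - now rewrite Rplus_0_r.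
  - rewrite S_INR, <- Rplus_assoc, per. apply IH. }
exists (frac_part t). split.
- destruct (base_fp t). lra.
- unfold frac_part. destruct (Z_le_gt_dec 0 (Int_part t)) as [le|gt].
  + destruct (IZN _ le) as [n ->]. rewrite <- INR_IZR_INZ.
    rewrite <- (pn n). f_equal. ring.
  + destruct (IZN (- Int_part t)) as [n en]; [Lia.lia|].
    replace (Int_part t) with (- Z.of_nat n)%Z by Lia.lia.
    rewrite opp_IZR, <- INR_IZR_INZ.
    rewrite <- (pn n t). f_equal. ring.
Qed.

Lemma RInt_pos_of_point (h : R -> R) (t : R) :
  (forall u, continuous h u) -> (forall u, 0 <= h u) -> 0 <= t <= 1 -> 0 < h t ->
  0 < RInt h 0 1.
Proof.
intros ch h0 ht hp.
destruct (ch t (fun v => 0 < v)) as [d hd].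
{ now apply open_gt. }
(* Clipping to [[0,1]] leaves an interval of positive length even when [t] is an endpoint. *)
pose (l := Rmax 0 (t - d / 2)). pose (r := Rmin 1 (t + d / 2)).
pose proof (cond_pos d) as dp.
assert (hl : 0 <= l /\ t - d / 2 <= l) by (split; [apply Rmax_l|apply Rmax_r]).
assert (hr : r <= 1 /\ r <= t + d / 2) by (split; [apply Rmin_l|apply Rmin_r]).
assert (lr : l < r).
{ unfold l, r. apply Rmax_case; apply Rmin_case; lra. }
assert (ex : forall a b, ex_RInt h a b) by (intros; now apply ex_RInt_of_continuous).
assert (e1 := RInt_Chasles h 0 l 1 (ex _ _) (ex _ _)).
assert (e2 := RInt_Chasles h l r 1 (ex _ _) (ex _ _)).
rewrite <- e1, <- e2. unfold plus; simpl.
assert (p1 : 0 <= RInt h 0 l) by (apply RInt_ge_0; [lra|apply ex|auto]).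
assert (p2 : 0 <= RInt h r 1) by (apply RInt_ge_0; [lra|apply ex|auto]).
assert (p3 : 0 < RInt h l r).
{ apply RInt_gt_0; [exact lr| |auto]. intros u hu. apply hd.
  change (Rabs (u - t) < d). apply Rabs_def1; lra. }
lra.
Qed.

Lemma continuous_dot {T : UniformSpace} (z w : T -> C) (x : T) :
  continuous z x -> continuous w x -> continuous (fun y => dot (z y) (w y)) x.
Proof.
intros cz cw.
assert (c1 : forall v : C, continuous (fun z : C => fst z) v) by (intros []; apply continuous_fst).
assert (c2 : forall v : C, continuous (fun z : C => snd z) v) by (intros []; apply continuous_snd).
apply (continuous_plus (V := R_NormedModule)); apply (continuous_mult (K := R_AbsRing)).
- now apply (continuous_comp z (fun v : C => fst v)).
- now apply (continuous_comp w (fun v : C => fst v)).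
- now apply (continuous_comp z (fun v : C => snd v)).
- now apply (continuous_comp w (fun v : C => snd v)).
Qed.

Lemma Cmod_sqr (z : C) : Cmod z ^ 2 = dot z z.
Proof.
unfold Cmod, dot. rewrite pow2_sqrt; [ring|].
apply Rplus_le_le_0_compat; apply pow2_ge_0.
Qed.

Lemma dot_ge_0 (z : C) : 0 <= dot z z.
Proof. unfold dot. nra. Qed.

Lemma dot_gt_0 (z : C) : z <> RtoC 0 -> 0 < dot z z.
Proof.
intros nz. rewrite <- Cmod_sqr. apply pow_lt. now apply Cmod_gt_0.
Qed.

Section LoopIntegrals.
Variables z X : R -> C.
Hypotheses (cz : forall t, continuous z t) (cX : forall t, continuous X t).

Lemma L2_inner_ge_0 : 0 <= L2_inner z z.
Proof.
apply RInt_ge_0; [lra| |intros; apply dot_ge_0].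
apply ex_RInt_of_continuous. intros; now apply continuous_dot.
Qed.

Lemma L2_norm_sqr : L2_norm z ^ 2 = L2_inner z z.
Proof. unfold L2_norm. apply pow2_sqrt, L2_inner_ge_0. Qed.

(** Without square root and modulus, the time change is a quotient of integrals of polynomials in
    the coordinates of the loop, a form that [action_term] can express. *)
Lemma time_change_dot t :
  time_change z t = / L2_inner z z * RInt (fun s => dot (z s) (z s)) 0 t.
Proof.
unfold time_change. rewrite L2_norm_sqr. f_equal.
apply RInt_ext. intros; apply Cmod_sqr.
Qed.

Lemma time_change_deriv_dot t :
  time_change_deriv z X t
  = 2 / L2_inner z z * RInt (fun s => dot (z s) (X s)) 0 t
    - 2 * L2_inner z X / L2_inner z z ^ 2 * RInt (fun s => dot (z s) (z s)) 0 t.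
Proof.
unfold time_change_deriv.
replace (L2_norm z ^ 4) with ((L2_norm z ^ 2) ^ 2) by ring. rewrite L2_norm_sqr.
do 2 f_equal. apply RInt_ext. intros; apply Cmod_sqr.
Qed.

Lemma RInt_dot_shift r t :
  RInt (fun s => dot (shift z X r s) (shift z X r s)) 0 t
  = RInt (fun s => dot (z s) (z s)) 0 t
    + (2 * r) * RInt (fun s => dot (z s) (X s)) 0 t
    + r ^ 2 * RInt (fun s => dot (X s) (X s)) 0 t.
Proof.
assert (ex : forall f g, (forall t, continuous f t) -> (forall t, continuous g t) ->
  ex_RInt (fun s => dot (f s) (g s)) 0 t).
{ intros f g cf cg. apply ex_RInt_of_continuous. intros; now apply continuous_dot. }
apply is_RInt_unique.
apply (is_RInt_ext (fun s => plus (plus (dot (z s) (z s))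
  (scal (2 * r) (dot (z s) (X s)))) (scal (r ^ 2) (dot (X s) (X s))))).
- intros s _. unfold plus, scal, shift, dot; simpl. unfold mult; simpl. ring.
- apply (is_RInt_plus (V := R_NormedModule)); [apply (is_RInt_plus (V := R_NormedModule))|].
  + apply (RInt_correct (V := R_CompleteNormedModule)). auto.
  + apply (is_RInt_scal (V := R_NormedModule)), (RInt_correct (V := R_CompleteNormedModule)). auto.
  + apply (is_RInt_scal (V := R_NormedModule)), (RInt_correct (V := R_CompleteNormedModule)). auto.
Qed.
End LoopIntegrals.

Lemma continuous_shift (z X : R -> C) (r t : R) :
  continuous z t -> continuous X t -> continuous (shift z X r) t.
Proof.
intros cz cX.
apply (continuous_plus (V := plane) z (fun t => scal r (X t))); [exact cz|].
now apply (continuous_scal_r (V := plane)).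
Qed.

(** Along [shift z X r], numerator and denominator of the time change are explicit quadratic
    polynomials in [r], so only a rational function has to be differentiated. *)
Lemma is_derive_time_change (z X : R -> C) (t : R) :
  (forall t, continuous z t) -> (forall t, continuous X t) -> 0 < L2_inner z z ->
  is_derive (fun r => time_change (shift z X r) t) 0 (time_change_deriv z X t).
Proof.
intros cz cX pos.
rewrite time_change_deriv_dot by assumption.
apply (is_derive_ext (fun r =>
  / (L2_inner z z + (2 * r) * L2_inner z X + r ^ 2 * L2_inner X X)
  * (RInt (fun s => dot (z s) (z s)) 0 t
    + (2 * r) * RInt (fun s => dot (z s) (X s)) 0 t
    + r ^ 2 * RInt (fun s => dot (X s) (X s)) 0 t))).
- intros r. rewrite time_change_dot by (intros; now apply continuous_shift).
  unfold L2_inner. now rewrite !RInt_dot_shift.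
- generalize (RInt (fun s => dot (z s) (z s)) 0 t)
    (RInt (fun s => dot (z s) (X s)) 0 t) (RInt (fun s => dot (X s) (X s)) 0 t).
  intros A B E. auto_derive.
  + replace (_ + _) with (L2_inner z z) by ring. lra.
  + field. lra.
Qed.

Lemma smooth_loop_continuous e z t : smooth_loop e z -> continuous z t.
Proof.
intros [sz _]. now apply (smooth_on_continuous (V := R_NormedModule) (W := plane) _ z t sz).
Qed.

Lemma smooth_loop_shift e z X r :
  smooth_loop e z -> smooth_loop e X -> smooth_loop e (shift z X r).
Proof.
intros [sz pz] [sX pX]. split.
- intros k. apply (Ck_on_plus (V := R_NormedModule) (W := plane) _ k z (fun t => scal r (X t))).
  + apply sz.
  + apply (Ck_on_linear (V := R_NormedModule) (W := plane) (W' := plane) _ k X (fun v => scal r v)).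
    * apply (is_linear_scal_r (K := R_AbsRing) (V := plane) r). exact Rmult_comm.
    * apply sX.
- intros t. unfold shift. rewrite pz, pX. destruct e; [reflexivity|].
  unfold Copp; simpl. f_equal; ring.
Qed.

Lemma varsigma_periodic e z : smooth_loop e z ->
  forall t, varsigma (z (t + 1)) = varsigma (z t).
Proof.
intros [_ pz] t. rewrite pz. destruct e; [reflexivity|]. unfold varsigma. ring.
Qed.

(** Periodicity moves a time where the loop is nonzero into [[0,1]]. The lemma makes the denominator
    of the time change invertible and, at the end, gives weak nondegeneracy. *)
Lemma L2_inner_pos e z : smooth_loop e z -> (exists t, z t <> RtoC 0) ->
  0 < L2_inner z z.
Proof.
intros lz [t nt].
destruct (periodic_unit_interval (fun t => dot (z t) (z t)) t) as [u [hu eu]].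
{ intros u. destruct lz as [_ pz]. rewrite pz. destruct e; [reflexivity|].
  unfold dot; simpl. ring. }
apply (RInt_pos_of_point _ u); auto.
- intros v. apply continuous_dot; now apply smooth_loop_continuous with e.
- intros v. apply dot_ge_0.
- rewrite eu. now apply dot_gt_0.
Qed.

Lemma plus_shift (X X' : paths) : plus X X' = shift X X' 1.
Proof.
apply functional_extensionality. intros t.
change ((fst (X t) + fst (X' t), snd (X t) + snd (X' t))
  = (fst (X t) + 1 * fst (X' t), snd (X t) + 1 * snd (X' t))).
now rewrite !Rmult_1_l.
Qed.

(** Sums, multiples and zero are all written as [shift], so that a single rule for [shift] gives
    additivity, homogeneity and the value at zero. *)
Lemma scal_shift (X : paths) (a : R) : scal a X = shift X X (a - 1).
Proof.
apply functional_extensionality. intros t.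
change ((a * fst (X t), a * snd (X t))
  = (fst (X t) + (a - 1) * fst (X t), snd (X t) + (a - 1) * snd (X t))).
f_equal; ring.
Qed.

Lemma zero_shift (X : paths) : (zero : paths) = shift X X (-1).
Proof.
apply functional_extensionality. intros t.
change ((0, 0) = (fst (X t) + -1 * fst (X t), snd (X t) + -1 * snd (X t))).
f_equal; ring.
Qed.

(** * Invariance under the sign involution *)

Lemma dot_opp (z w : C) : dot (opp (z : plane)) (opp (w : plane)) = dot z w.
Proof.
change ((- fst z) * (- fst w) + (- snd z) * (- snd w) = dot z w). unfold dot. ring.
Qed.

(** Both [varsigma z] and the vector [2 z w] are unchanged when [z] and [w] change sign together. *)
Lemma pullback_opp theta t (z w : C) :
  pullback theta t (opp (z : plane)) (opp (w : plane)) = pullback theta t z w.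
Proof.
change (pullback theta t (Copp z) (Copp w) = pullback theta t z w).
unfold pullback, varsigma. f_equal; ring.
Qed.

Lemma L2_inner_opp (z w : paths) : L2_inner (opp z) (opp w) = L2_inner z w.
Proof. apply RInt_ext. intros t _. apply dot_opp. Qed.

Lemma RInt_Cmod_opp (z : paths) t :
  RInt (fun s => Cmod ((opp z : paths) s) ^ 2) 0 t = RInt (fun s => Cmod (z s) ^ 2) 0 t.
Proof.
apply RInt_ext. intros s _. rewrite !Cmod_sqr. apply dot_opp.
Qed.

Lemma time_change_opp (z : paths) t : time_change (opp z) t = time_change z t.
Proof.
unfold time_change, L2_norm. now rewrite L2_inner_opp, RInt_Cmod_opp.
Qed.

Lemma time_change_deriv_opp (z X : paths) t :
  time_change_deriv (opp z) (opp X) t = time_change_deriv z X t.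
Proof.
unfold time_change_deriv, L2_norm. rewrite !L2_inner_opp, RInt_Cmod_opp.
do 2 f_equal. apply RInt_ext. intros s _. apply dot_opp.
Qed.

Lemma Sigma_opp theta (z X Y : paths) :
  Sigma theta (opp z) (opp X) (opp Y) = Sigma theta z X Y.
Proof.
assert (he : forall t u v w, ext_deriv_one_form (pullback theta t)
  (opp (u : plane)) (opp (v : plane)) (opp (w : plane))
  = ext_deriv_one_form (pullback theta t) u v w).
{ intros t u v w.
  assert (h : forall v w s, pullback theta t
    ((opp (u : plane) : C) + RtoC s * (opp (v : plane) : C))%C (opp (w : plane))
    = pullback theta t (u + RtoC s * v)%C w).
  { clear v w. intros v w s. etransitivity; [|apply pullback_opp].
    apply (f_equal (fun p => pullback theta t p (opp (w : plane)))).
    change ((Copp u + RtoC s * Copp v)%C = Copp (u + RtoC s * v)%C). ring. }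
  unfold ext_deriv_one_form. apply (f_equal2 Rminus); apply Derive_ext; intros s; apply h. }
assert (ht : forall t u w, time_deriv (pullback theta) t (opp (u : plane)) (opp (w : plane))
  = time_deriv (pullback theta) t u w).
{ intros t u w. apply Derive_ext. intros s. apply pullback_opp. }
apply RInt_ext. intros t _.
rewrite time_change_opp, !time_change_deriv_opp.
apply (f_equal2 Rminus); [apply (f_equal2 Rplus)|].
- apply he.
- apply f_equal. apply ht.
- apply f_equal. apply ht.
Qed.

(** * Linearity of the pairing and of the derivative of the time change *)

Lemma dot_sym (z w : C) : dot z w = dot w z.
Proof. unfold dot. ring. Qed.

Lemma L2_inner_sym (z w : R -> C) : L2_inner z w = L2_inner w z.
Proof. apply RInt_ext. intros t _. apply dot_sym. Qed.

Lemma RInt_shift (f g : R -> R) a b r :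
  (forall t, continuous f t) -> (forall t, continuous g t) ->
  RInt (fun t => f t + r * g t) a b = RInt f a b + r * RInt g a b.
Proof.
intros cf cg. apply is_RInt_unique.
apply (is_RInt_plus (V := R_NormedModule)); [|apply (is_RInt_scal (V := R_NormedModule))];
  apply (RInt_correct (V := R_CompleteNormedModule)); now apply ex_RInt_of_continuous.
Qed.

Lemma dot_shift_r (v : C) (X X' : R -> C) r t :
  dot v (shift X X' r t) = dot v (X t) + r * dot v (X' t).
Proof. unfold dot, shift; simpl. ring. Qed.

Lemma RInt_dot_shift_r (z X X' : R -> C) r a b :
  (forall t, continuous z t) -> (forall t, continuous X t) -> (forall t, continuous X' t) ->
  RInt (fun t => dot (z t) (shift X X' r t)) a b
  = RInt (fun t => dot (z t) (X t)) a b + r * RInt (fun t => dot (z t) (X' t)) a b.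
Proof.
intros cz cX cX'.
rewrite <- RInt_shift by (intros; now apply continuous_dot).
apply RInt_ext. intros t _. apply dot_shift_r.
Qed.

Lemma time_change_deriv_shift (z X X' : R -> C) r t :
  (forall t, continuous z t) -> (forall t, continuous X t) -> (forall t, continuous X' t) ->
  time_change_deriv z (shift X X' r) t
  = time_change_deriv z X t + r * time_change_deriv z X' t.
Proof.
intros cz cX cX'. unfold time_change_deriv, L2_inner.
rewrite !RInt_dot_shift_r by assumption. unfold Rdiv. ring.
Qed.

Lemma L2_inner_shift_r e (z X X' : R -> C) r :
  smooth_loop e z -> smooth_loop e X -> smooth_loop e X' ->
  L2_inner z (shift X X' r) = L2_inner z X + r * L2_inner z X'.
Proof.
intros lz lX lX'.
apply RInt_dot_shift_r; intros; now apply smooth_loop_continuous with e.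
Qed.

Lemma L2_inner_shift_l e (z X X' : R -> C) r :
  smooth_loop e z -> smooth_loop e X -> smooth_loop e X' ->
  L2_inner (shift X X' r) z = L2_inner X z + r * L2_inner X' z.
Proof.
intros lz lX lX'. rewrite L2_inner_sym, (L2_inner_shift_r e) by assumption.
now rewrite (L2_inner_sym z X), (L2_inner_sym z X').
Qed.

(** * Smooth families of loops *)

Lemma sheet_re Q D U h : smooth_path_of_loops D h ->
  action_term Q D U (fun p => fst (h (fst (fst p)) (snd p))).
Proof.
intros sh. apply (term_sheet Q D U (fun p => fst (h (fst p) (snd p)))).
intros k.
exact (Ck_on_linear (V := R_NormedModule *n R_NormedModule) (W := plane) (W' := R_NormedModule)
  _ k _ (fun v : C => fst v) is_linear_re (sh k)).
Qed.

Lemma sheet_im Q D U h : smooth_path_of_loops D h ->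
  action_term Q D U (fun p => snd (h (fst (fst p)) (snd p))).
Proof.
intros sh. apply (term_sheet Q D U (fun p => snd (h (fst p) (snd p)))).
intros k.
exact (Ck_on_linear (V := R_NormedModule *n R_NormedModule) (W := plane) (W' := R_NormedModule)
  _ k _ (fun v : C => snd v) is_linear_im (sh k)).
Qed.

Lemma smooth_L2_inner (D : R -> Prop) (A B : R -> R -> C) :
  open D -> smooth_path_of_loops D A -> smooth_path_of_loops D B ->
  smooth_on (V := R_NormedModule) (W := R_NormedModule) D (fun s => L2_inner (A s) (B s)).
Proof.
intros oD sA sB.
pose (Q := fun _ : C => True). pose (U := fun p : R * R => D (fst p)).
assert (oQ : open Q) by (intros x _; now apply filter_forall).
assert (oU : open U).
{ intros [s r] Ds. apply (continuous_fst (U := R_UniformSpace) (V := R_UniformSpace) s r).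
  now apply oD. }
assert (UD : forall s r, U (s, r) -> D s) by (intros s r h; exact h).
apply (action_term_smooth Q D U oQ oD oU UD
  (fun p => RInt (fun t => dot (A (fst (fst p)) t) (B (fst (fst p)) t)) 0 (snd p)));
  [|auto].
apply (term_primitive Q D U (fun p => dot (A (fst (fst p)) (snd p)) (B (fst (fst p)) (snd p)))).
unfold dot. apply term_plus; apply term_mult; now (apply sheet_re || apply sheet_im).
Qed.

Lemma open_all : open (fun _ : R => True).
Proof. intros x _. now apply filter_forall. Qed.

Lemma smooth_path_const e (z : R -> C) : smooth_loop e z ->
  smooth_path_of_loops (fun _ => True) (fun _ => z).
Proof.
intros [sz _] k.
exact (Ck_on_precomp_linear (V := R_NormedModule *n R_NormedModule) (V' := R_NormedModule)
  (W := plane) (fun _ => True) k z (fun p => snd p) is_linear_snd (sz k)).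
Qed.

(** The recursion in [Ck_on] does not literally contain the lower orders. On the line, the
    derivative in direction [1] is the ordinary derivative, so its existence gives continuity, and
    the higher orders follow by induction. *)
Lemma Ck_on_pred {W : NormedModule R_AbsRing} (h : R -> W) k :
  Ck_on (V := R_NormedModule) (fun _ => True) (S k) h ->
  Ck_on (V := R_NormedModule) (fun _ => True) k h.
Proof.
revert h. induction k as [|k IH]; intros h H.
- intros x _. destruct (H 1) as [g [hg _]].
  apply (ex_derive_continuous (V := W)).
  exists (g x). apply (is_derive_ext (fun y => h (plus x (scal (y - x) 1)))).
  + intros t. f_equal. unfold plus, scal; simpl. unfold mult; simpl.
    match goal with |- ?l = ?r => change (@eq R l r) end. ring.
  + rewrite <- (scal_one (g x)).
    apply (is_derive_comp (V := W) (fun s : R => h (plus x (scal s 1))) (fun y : R => y - x)).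
    * rewrite Rminus_diag. now apply hg.
    * auto_derive; [easy|reflexivity].
- intros v. destruct (H v) as [g [hg cg]]. exists g. split; [exact hg|now apply IH].
Qed.

Lemma Ck_on_fst_scal (h : R -> C) k :
  Ck_on (V := R_NormedModule) (W := plane) (fun _ => True) k h ->
  Ck_on (V := R_NormedModule *n R_NormedModule) (W := plane) (fun _ => True) k
    (fun p => scal (fst p) (h (snd p) : plane)).
Proof.
revert h. induction k as [|k IH]; intros h H.
- intros [a b] _.
  apply (continuous_scal (V := plane) (fun p : R * R => fst p) (fun p : R * R => h (snd p))).
  + apply continuous_fst.
  + apply (continuous_comp (fun p : R * R => snd p) h); [apply continuous_snd|now apply H].
- intros v. destruct (H (snd v)) as [g [hg cg]].
  (* The product rule. The first summand involves [h] itself, now needed at order [k] only, which is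
     where [Ck_on_pred] enters. *)
  exists (fun p => plus (scal (fst v) (h (snd p) : plane)) (scal (fst p) (g (snd p) : plane))).
  split.
  + intros x _.
    assert (h1 : is_derive (fun s : R => plus (fst x) (scal s (fst v))) 0 (fst v)).
    { unfold plus, scal; simpl. unfold mult; simpl.
      generalize (fst x : R) (fst v : R). intros a b. auto_derive; [easy|ring]. }
    assert (h2 := filterdiff_scal_fct (V := plane) 0
      (fun s : R => plus (fst x) (scal s (fst v)))
      (fun s : R => h (plus (snd x) (scal s (snd v)))) _ _ Rmult_comm h1 (hg (snd x) I)).
    cbv beta in h2.
    apply (filterdiff_ext_lin _ _ _ h2). intros y.
    assert (e : forall a b : R, plus a (scal 0 b) = a).
    { intros a b. unfold plus, scal; simpl. unfold mult; simpl. ring. }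
    rewrite scal_distr_l, !scal_assoc.
    apply (f_equal2 plus).
    * apply (f_equal (fun w => scal (mult y (fst v)) (h w : plane))). exact (e (snd x) (snd v)).
    * apply (f_equal (fun w => scal w (g (snd x) : plane))).
      etransitivity; [|exact (Rmult_comm (fst x) y)].
      apply (f_equal (fun w => Rmult w y)). exact (e (fst x) (fst v)).
  + apply (Ck_on_plus (V := R_NormedModule *n R_NormedModule) (W := plane) _ k
      (fun p => scal (fst v) (h (snd p) : plane)) (fun p => scal (fst p) (g (snd p) : plane))).
    * apply (Ck_on_linear (V := R_NormedModule *n R_NormedModule) (W := plane) (W' := plane)
        _ k (fun p => h (snd p)) (fun w => scal (fst v) w)).
      -- apply (is_linear_scal_r (K := R_AbsRing) (V := plane) (fst v)). exact Rmult_comm.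
      -- exact (Ck_on_precomp_linear (V := R_NormedModule *n R_NormedModule) (V' := R_NormedModule)
           (W := plane) (fun _ => True) k h (fun p => snd p) is_linear_snd (Ck_on_pred h k H)).
    * now apply IH.
Qed.

Lemma smooth_path_shift e (z X : R -> C) : smooth_loop e z -> smooth_loop e X ->
  smooth_path_of_loops (fun _ => True) (shift z X).
Proof.
intros lz lX k.
apply (Ck_on_plus (V := R_NormedModule *n R_NormedModule) (W := plane) _ k
  (fun p => z (snd p)) (fun p => scal (fst p) (X (snd p) : plane))).
- exact (smooth_path_const e z lz k).
- apply Ck_on_fst_scal. apply lX.
Qed.

(** * The magnetic form *)

(** With [im2], the coordinates of [2 z w], the differential of [varsigma] at [z] applied to [w]. *)
Definition re2 (z w : C) : R := 2 * (fst z * fst w - snd z * snd w).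
Definition im2 (z w : C) : R := 2 * (fst z * snd w + snd z * fst w).

(* A 1-form in [W] at the loop [z]; [Sigma] is its exterior derivative. *)
Definition action (theta : R -> C -> C -> R) (z W : R -> C) : R :=
  RInt (fun t => pullback theta (time_change z t) (z t) (W t)) 0 1.

Section MagneticForm.
Variables (Q : C -> Prop) (theta : R -> C -> C -> R).
Hypotheses (openQ : open Q) (htheta : smooth_family_of_one_forms Q theta).

(** The two components of [theta] in the standard basis. Smoothness of the family is expressed for
    fixed tangent vectors, so the calculus is done on these scalar functions, whose partial
    derivatives in time, real part and imaginary part carry the indices 1, 2, 3. *)
Let ga (p : R * C) : R := theta (fst p) (snd p) (1, 0).
Let gb (p : R * C) : R := theta (fst p) (snd p) (0, 1).

Variables ga1 ga2 ga3 gb1 gb2 gb3 : R * C -> R.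
Hypotheses (sa1 : smooth_st Q ga1) (sa2 : smooth_st Q ga2)
  (sb1 : smooth_st Q gb1) (sb2 : smooth_st Q gb2)
  (pa : partials_st Q ga ga1 ga2 ga3) (pb : partials_st Q gb gb1 gb2 gb3).

Lemma smooth_ga : smooth_st Q ga.
Proof. apply htheta. Qed.

Lemma smooth_gb : smooth_st Q gb.
Proof. apply htheta. Qed.

Lemma pullback_expand (t : R) (z w : C) : Q (varsigma z) ->
  pullback theta t z w
  = re2 z w * ga (t, varsigma z) + im2 z w * gb (t, varsigma z).
Proof.
intros q. unfold pullback, ga, gb; simpl.
assert (lin := proj1 htheta t (varsigma z) q).
assert (e : (RtoC 2 * z * w)%C
  = plus (scal (re2 z w) ((1, 0) : plane)) (scal (im2 z w) ((0, 1) : plane))).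
{ destruct z as [a b], w as [c d].
  change ((RtoC 2 * (a, b) * (c, d))%C
    = (re2 (a, b) (c, d) * 1 + im2 (a, b) (c, d) * 0,
       re2 (a, b) (c, d) * 0 + im2 (a, b) (c, d) * 1)).
  unfold RtoC, Cmult, re2, im2; simpl. f_equal; ring. }
rewrite e. rewrite (linear_plus _ lin), !(linear_scal _ lin). reflexivity.
Qed.

Definition pullback_dt (t : R) (z w : C) : R :=
  re2 z w * ga1 (t, varsigma z) + im2 z w * gb1 (t, varsigma z).

(** The derivative of [pullback theta t z w] in [z] along [v]. The first line differentiates the
    coefficients [2 z w]; the other two differentiate the components of [theta] at [varsigma z],
    which moves with velocity [2 z v]. *)
Definition pullback_dz (t : R) (z v w : C) : R :=
  re2 v w * ga (t, varsigma z) + im2 v w * gb (t, varsigma z)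
  + re2 z w * (re2 z v * ga2 (t, varsigma z) + im2 z v * ga3 (t, varsigma z))
  + im2 z w * (re2 z v * gb2 (t, varsigma z) + im2 z v * gb3 (t, varsigma z)).

Lemma time_deriv_pullback t z w : Q (varsigma z) ->
  time_deriv (pullback theta) t z w = pullback_dt t z w.
Proof.
intros q. apply is_derive_unique.
apply (is_derive_ext (fun s => re2 z w * ga (s, varsigma z) + im2 z w * gb (s, varsigma z))).
- intros s. now rewrite pullback_expand.
- destruct (varsigma z) as [a b] eqn:e. unfold pullback_dt. rewrite e.
  apply (is_derive_plus (V := R_NormedModule)); apply is_derive_scal.
  + now apply pa.
  + now apply pb.
Qed.

Definition point_shift (z v : C) (r : R) : C := (fst z + r * fst v, snd z + r * snd v).

Lemma continuous_point_shift (z v : C) (r : R) : continuous (point_shift z v) r.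
Proof. exact (continuous_line (V := plane) z v r). Qed.

Lemma is_derive_sqr_re (z v : C) :
  is_derive (fun r => fst (varsigma (point_shift z v r))) 0 (re2 z v).
Proof. unfold varsigma, point_shift, re2; simpl. auto_derive; [easy|ring]. Qed.

Lemma is_derive_sqr_im (z v : C) :
  is_derive (fun r => snd (varsigma (point_shift z v r))) 0 (im2 z v).
Proof. unfold varsigma, point_shift, im2; simpl. auto_derive; [easy|ring]. Qed.

Lemma point_shift_0 (z v : C) : point_shift z v 0 = z.
Proof. unfold point_shift. destruct z; simpl. f_equal; ring. Qed.

Lemma is_derive_varsigma_comp g g1 g2 g3 (f : R -> R) (d : R) (z v : C) :
  smooth_st Q g1 -> smooth_st Q g2 -> partials_st Q g g1 g2 g3 ->
  Q (varsigma z) -> is_derive f 0 d ->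
  is_derive (fun r => g (f r, varsigma (point_shift z v r))) 0
    (d * g1 (f 0, varsigma z) + re2 z v * g2 (f 0, varsigma z)
     + im2 z v * g3 (f 0, varsigma z)).
Proof.
intros s1 s2 pg q hf.
assert (h := is_derive_comp_st Q openQ g g1 g2 g3 f
  (fun r => fst (varsigma (point_shift z v r))) (fun r => snd (varsigma (point_shift z v r)))
  0 d (re2 z v) (im2 z v) s1 s2 pg).
cbv beta in h. rewrite point_shift_0, <- surjective_pairing in h.
apply h; auto using is_derive_sqr_re, is_derive_sqr_im.
Qed.

Lemma continuous_varsigma (z : C) : continuous varsigma z.
Proof.
destruct z as [a b].
assert (c1 : continuous (fun z : C => fst z) (a, b)) by apply continuous_fst.
assert (c2 : continuous (fun z : C => snd z) (a, b)) by apply continuous_snd.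
apply (continuous_comp_2 (fun z : C => fst z * fst z - snd z * snd z)
  (fun z : C => fst z * snd z + snd z * fst z) (fun a b => (a, b))).
- apply (continuous_minus (V := R_NormedModule)); now apply (continuous_mult (K := R_AbsRing)).
- apply (continuous_plus (V := R_NormedModule)); now apply (continuous_mult (K := R_AbsRing)).
- apply (continuous_ext (fun p => p)); [now intros []|apply continuous_id].
Qed.

(** Time varies together with the point because displacing a loop also changes its time change; [f]
    stands for that dependence at a fixed instant. *)
Lemma is_derive_pullback (f : R -> R) (d : R) (z v w : C) :
  Q (varsigma z) -> is_derive f 0 d ->
  is_derive (fun r => pullback theta (f r) (point_shift z v r) w) 0
    (d * pullback_dt (f 0) z w + pullback_dz (f 0) z v w).
Proof.
intros q hf.
apply (is_derive_ext_loc (fun r =>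
  re2 (point_shift z v r) w * ga (f r, varsigma (point_shift z v r))
  + im2 (point_shift z v r) w * gb (f r, varsigma (point_shift z v r)))).
- apply (filter_imp (fun r => Q (varsigma (point_shift z v r)))).
  + intros r qr. now rewrite pullback_expand.
  + apply (continuous_comp (point_shift z v) varsigma 0).
    * apply continuous_point_shift.
    * apply continuous_varsigma.
    * apply openQ. now rewrite point_shift_0.
- assert (h1 := is_derive_varsigma_comp ga ga1 ga2 ga3 f d z v sa1 sa2 pa q hf).
  assert (h2 := is_derive_varsigma_comp gb gb1 gb2 gb3 f d z v sb1 sb2 pb q hf).
  assert (k1 : is_derive (fun r => re2 (point_shift z v r) w) 0 (re2 v w)).
  { unfold re2, point_shift; simpl. auto_derive; [easy|ring]. }
  assert (k2 : is_derive (fun r => im2 (point_shift z v r) w) 0 (im2 v w)).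
  { unfold im2, point_shift; simpl. auto_derive; [easy|ring]. }
  assert (h := is_derive_plus (V := R_NormedModule) _ _ _ _ _
    (is_derive_mult (K := R_AbsRing) _ _ _ _ _ k1 h1 Rmult_comm)
    (is_derive_mult (K := R_AbsRing) _ _ _ _ _ k2 h2 Rmult_comm)).
  cbv beta in h. rewrite point_shift_0 in h.
  match type of h with is_derive _ _ ?l =>
    replace (d * pullback_dt (f 0) z w + pullback_dz (f 0) z v w) with l; [exact h|] end.
  unfold pullback_dt, pullback_dz, plus, mult; simpl.
  unfold mult; simpl. ring.
Qed.

Lemma ext_deriv_pullback t z v w : Q (varsigma z) ->
  ext_deriv_one_form (pullback theta t) z v w = pullback_dz t z v w - pullback_dz t z w v.
Proof.
intros q.
assert (h : forall v w, Derive (fun s => pullback theta t (z + RtoC s * v)%C w) 0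
  = pullback_dz t z v w).
{ clear v w. intros v w. apply is_derive_unique.
  apply (is_derive_ext (fun r => pullback theta t (point_shift z v r) w)).
  - intros r. f_equal. unfold point_shift. destruct z, v.
    unfold Cplus, Cmult, RtoC; simpl. f_equal; ring.
  - assert (h := is_derive_pullback (fun _ => t) 0 z v w q
      (is_derive_const (V := R_NormedModule) t 0)).
    cbv beta in h. now rewrite Rmult_0_l, Rplus_0_l in h. }
unfold ext_deriv_one_form. now rewrite !h.
Qed.

(** The derivative at [r = 0] of the integrand of [action theta (shift z X r) W]: the first summand
    comes from the time change, the second from the moving point. *)
Definition action_density (z X W : R -> C) (t : R) : R :=
  time_change_deriv z X t * pullback_dt (time_change z t) (z t) (W t)
  + pullback_dz (time_change z t) (z t) (X t) (W t).

(** Exactness at the level of integrands: antisymmetrizing the moving-point part gives the exterior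
    derivative of the pull-back, and antisymmetrizing the time part gives the two terms with the
    time derivative. *)
Lemma Sigma_density z X Y : (forall t, Q (varsigma (z t))) ->
  Sigma theta z X Y = RInt (fun t => action_density z X Y t - action_density z Y X t) 0 1.
Proof.
intros q. apply RInt_ext. intros t _.
rewrite ext_deriv_pullback, !time_deriv_pullback by apply q.
unfold action_density. match goal with |- ?l = ?r => change (@eq R l r) end. ring.
Qed.

(** * The action on two-parameter families of loops *)

Section Family.
Variables (D : R -> Prop) (e : parity) (c X W : R -> R -> C).
Hypotheses (openD : open D)
  (sc : smooth_path_of_loops D c) (sX : smooth_path_of_loops D X)
  (sW : smooth_path_of_loops D W)
  (lc : forall s, D s -> smooth_loop e (c s)) (lX : forall s, D s -> smooth_loop e (X s)).

(** The parameters for which the displaced loop is still a point of the loop space: there [theta] is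
    evaluated inside [Q] and the denominator of the time change is positive. *)
Definition family_domain (p : R * R) : Prop :=
  D (fst p) /\ loop_point Q e (shift (c (fst p)) (X (fst p)) (snd p)).

Lemma smooth_path_continuous (h : R -> R -> C) s t :
  smooth_path_of_loops D h -> D s ->
  continuous (fun p : R * R => h (fst p) (snd p)) (s, t).
Proof.
intros sh Ds.
exact (smooth_on_continuous (V := R_NormedModule *n R_NormedModule) (W := plane)
  _ _ (s, t) sh Ds).
Qed.

Lemma continuous_family s r t : D s ->
  continuous (fun p : (R * R) * R => shift (c (fst (fst p))) (X (fst (fst p))) (snd (fst p)) (snd p))
    ((s, r), t).
Proof.
intros Ds.
assert (cst : continuous (fun p : (R * R) * R => (fst (fst p), snd p)) ((s, r), t)).
{ intros P [d hd]. exists d. intros [[a b] u] [[h1 h2] h3]. apply hd. now split. }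
assert (cr : continuous (fun p : (R * R) * R => snd (fst p)) ((s, r), t)).
{ intros P [d hd]. exists d. intros [[a b] u] [[h1 h2] h3]. now apply hd. }
apply (continuous_plus (V := plane)
  (fun p : (R * R) * R => c (fst (fst p)) (snd p))
  (fun p : (R * R) * R => scal (snd (fst p)) (X (fst (fst p)) (snd p) : plane))).
- apply (continuous_comp (fun p : (R * R) * R => (fst (fst p), snd p))
    (fun p : R * R => c (fst p) (snd p)) _ cst).
  now apply smooth_path_continuous.
- apply (continuous_scal (V := plane) (fun p : (R * R) * R => snd (fst p))
    (fun p : (R * R) * R => X (fst (fst p)) (snd p)) _ cr).
  apply (continuous_comp (fun p : (R * R) * R => (fst (fst p), snd p))
    (fun p : R * R => X (fst p) (snd p)) _ cst).
  now apply smooth_path_continuous.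
Qed.

(** Staying in [Q] is open over [[0,1]] by [tube_lemma] and extends to all times by periodicity. Not
    being identically zero is open because one instant [t0] with nonzero value keeps it under small
    changes of the parameters. *)
Lemma open_family_domain : open family_domain.
Proof.
intros [s r] [Ds [_ [q [t0 nz]]]]. simpl in Ds, q, nz.
assert (hD : locally (s, r) (fun p : R * R => D (fst p))).
{ apply (continuous_fst (U := R_UniformSpace) (V := R_UniformSpace) s r). now apply openD. }
assert (hq : locally (s, r) (fun p : R * R => forall t, 0 <= t <= 1 ->
  Q (varsigma (shift (c (fst p)) (X (fst p)) (snd p) t)))).
{ apply (tube_lemma (s, r) (fun p t => Q (varsigma (shift (c (fst p)) (X (fst p)) (snd p) t)))).
  intros t _.
  apply (continuous_comp _ varsigma _ (continuous_family s r t Ds) (continuous_varsigma _) Q).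
  apply openQ, q. }
assert (hn : locally (s, r) (fun p : R * R =>
  0 < dot (shift (c (fst p)) (X (fst p)) (snd p) t0) (shift (c (fst p)) (X (fst p)) (snd p) t0))).
{ assert (ct := continuous_family s r t0 Ds).
  assert (cd := continuous_dot _ _ _ ct ct).
  apply continuous_pair_l in cd. apply (cd (fun v => 0 < v)).
  apply open_gt. simpl. now apply dot_gt_0. }
generalize (filter_and _ _ hD (filter_and _ _ hq hn)). apply filter_imp.
intros [s' r'] [Ds' [q' n']]. simpl in Ds', q', n'.
assert (ls : smooth_loop e (shift (c s') (X s') r')) by (apply smooth_loop_shift; auto).
split; [exact Ds'|split; [exact ls|split]]; simpl.
- intros t.
  destruct (periodic_unit_interval (fun t => varsigma (shift (c s') (X s') r' t)) t)
    as [u [hu eu]].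
  { now apply varsigma_periodic with e. }
  rewrite <- eu. now apply q'.
- exists t0. intros z0. rewrite z0 in n'. unfold dot in n'; simpl in n'. lra.
Qed.

Lemma family_domain_D s r : family_domain (s, r) -> D s.
Proof. now intros [Ds _]. Qed.

Let term := action_term Q D family_domain.

Lemma term_family_re :
  term (fun p => fst (shift (c (fst (fst p))) (X (fst (fst p))) (snd (fst p)) (snd p))).
Proof.
apply (term_plus Q D family_domain (fun p => fst (c (fst (fst p)) (snd p)))
  (fun p => snd (fst p) * fst (X (fst (fst p)) (snd p)))).
- now apply sheet_re.
- apply (term_mult Q D family_domain (fun p => snd (fst p))
    (fun p => fst (X (fst (fst p)) (snd p)))).
  + constructor.
  + now apply sheet_re.
Qed.

Lemma term_family_im :
  term (fun p => snd (shift (c (fst (fst p))) (X (fst (fst p))) (snd (fst p)) (snd p))).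
Proof.
apply (term_plus Q D family_domain (fun p => snd (c (fst (fst p)) (snd p)))
  (fun p => snd (fst p) * snd (X (fst (fst p)) (snd p)))).
- now apply sheet_im.
- apply (term_mult Q D family_domain (fun p => snd (fst p))
    (fun p => snd (X (fst (fst p)) (snd p)))).
  + constructor.
  + now apply sheet_im.
Qed.

Let fam (p : (R * R) * R) : C := shift (c (fst (fst p))) (X (fst (fst p))) (snd (fst p)) (snd p).

Lemma term_minus f g : term f -> term g -> term (fun p => f p + -1 * g p).
Proof.
intros hf hg. apply (term_plus Q D family_domain f (fun p => -1 * g p)); [exact hf|].
apply (term_mult Q D family_domain (fun _ => -1) g); [constructor|exact hg].
Qed.

Lemma exists_action_term : exists body, term body /\
  forall s r t, family_domain (s, r) ->
    body ((s, r), t) = pullback theta (time_change (shift (c s) (X s) r) t)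
      (shift (c s) (X s) r t) (W s t).
Proof.
pose (x := fun p => fst (fam p)). pose (y := fun p => snd (fam p)).
pose (u := fun p : (R * R) * R => fst (W (fst (fst p)) (snd p))).
pose (v := fun p : (R * R) * R => snd (W (fst (fst p)) (snd p))).
assert (tx : term x) by exact term_family_re.
assert (ty : term y) by exact term_family_im.
assert (tu : term u) by now apply sheet_re.
assert (tv : term v) by now apply sheet_im.
assert (tm : forall f g, term f -> term g -> term (fun p => f p * g p))
  by (intros; now apply term_mult).
assert (tp : forall f g, term f -> term g -> term (fun p => f p + g p))
  by (intros; now apply term_plus).
pose (n := fun p => RInt (fun t => x (fst p, t) * x (fst p, t) + y (fst p, t) * y (fst p, t)) 0 (snd p)).
assert (tn : term n).
{ apply (term_primitive Q D family_domain (fun p => x p * x p + y p * y p)).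
  apply tp; now apply tm. }
assert (en : forall s r t, n ((s, r), t)
   = RInt (fun t => dot (shift (c s) (X s) r t) (shift (c s) (X s) r t)) 0 t) by reflexivity.
(* The time change in the form of [time_change_dot]. The inverse is admissible because the loops in
   [family_domain] are not identically zero, so [n] at [1] is positive. *)
pose (T := fun p => / n (fst p, 1) * n p).
assert (tT : term T).
{ apply (tm (fun p => / n (fst p, 1)) n); [|exact tn].
  apply (term_inv Q D family_domain (fun p => n (fst p, 1))).
  - now apply term_end.
  - intros [s r] t [_ [ls [_ nz]]]. simpl in ls, nz. simpl fst. rewrite en.
    apply Rgt_not_eq. exact (L2_inner_pos e _ ls nz). }
pose (q1 := fun p => x p * x p + -1 * (y p * y p)).
pose (q2 := fun p => x p * y p + y p * x p).
assert (tq1 : term q1) by (apply term_minus; auto).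
assert (tq2 : term q2) by (apply tp; auto).
assert (eq : forall p, (q1 p, q2 p) = varsigma (fam p)).
{ intros p. unfold q1, q2, varsigma, Cmult. fold (x p) (y p). f_equal. ring. }
assert (hq : forall p t, family_domain p -> Q (q1 (p, t), q2 (p, t))).
{ intros [s r] t [_ [_ [q _]]]. rewrite eq. apply q. }
exists (fun p => 2 * (x p * u p + -1 * (y p * v p)) * ga (T p, (q1 p, q2 p))
  + 2 * (x p * v p + y p * u p) * gb (T p, (q1 p, q2 p))).
split.
- apply tp; apply tm.
  + apply tm; [constructor|apply term_minus; auto].
  + apply term_comp; auto using smooth_ga.
  + apply tm; [constructor|auto].
  + apply term_comp; auto using smooth_gb.
- intros s r t [Ds [ls [q nz]]]. simpl in ls, q, nz.
  rewrite pullback_expand by apply q.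
  rewrite eq. rewrite time_change_dot by (intros; now apply smooth_loop_continuous with e).
  unfold T. simpl fst. rewrite !en. unfold re2, im2, L2_inner.
  apply f_equal2; apply f_equal2; try reflexivity; unfold x, y, u, v, fam; simpl; ring.
Qed.

Lemma exists_action_primitive : exists L, term L /\
  forall s r, family_domain (s, r) ->
    L ((s, r), 1) = action theta (shift (c s) (X s) r) (W s).
Proof.
destruct exists_action_term as [body [tb eb]].
exists (fun p => RInt (fun t => body (fst p, t)) 0 (snd p)). split.
- now apply term_primitive.
- intros s r dom. apply RInt_ext. intros t _. now apply eb.
Qed.

(** The term and the action agree on [family_domain] only; since that set is open, their derivatives
    agree as well. *)
Lemma Derive_action_r L s r :
  (forall s r, family_domain (s, r) ->
    L ((s, r), 1) = action theta (shift (c s) (X s) r) (W s)) ->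
  family_domain (s, r) ->
  Derive (fun v => action theta (shift (c s) (X s) v) (W s)) r
  = Derive (fun v => L ((s, v), 1)) r.
Proof.
intros eL dom. apply Derive_ext_loc.
generalize (locally_U_r family_domain open_family_domain s r dom).
apply filter_imp. intros v dv. now rewrite eL.
Qed.

Lemma Derive_action_s L s r :
  (forall s r, family_domain (s, r) ->
    L ((s, r), 1) = action theta (shift (c s) (X s) r) (W s)) ->
  family_domain (s, r) ->
  Derive (fun u => action theta (shift (c u) (X u) r) (W u)) s
  = Derive (fun u => L ((u, r), 1)) s.
Proof.
intros eL dom. apply Derive_ext_loc.
generalize (locally_U_l family_domain open_family_domain s r dom).
apply filter_imp. intros u du. now rewrite eL.
Qed.

(** The [r]-derivative of the term representing the action is again a term, and terms are smooth in
    [s] on the slice [r = 0]. *)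
Lemma smooth_Derive_action : (forall s, D s -> family_domain (s, 0)) ->
  smooth_on (V := R_NormedModule) (W := R_NormedModule) D
    (fun s => Derive (fun r => action theta (shift (c s) (X s) r) (W s)) 0).
Proof.
intros dom k.
destruct exists_action_primitive as [L [tL eL]].
destruct (action_term_partials Q D family_domain openQ openD open_family_domain
  family_domain_D L tL) as [Ls [Lr [Lt [ts [tr [tt hL]]]]]].
apply (Ck_on_ext (V := R_NormedModule) (W := R_NormedModule) D k
  (fun s => Lr ((s, 0), 1))).
- exact openD.
- intros s Ds. rewrite (Derive_action_r L s 0 eL) by auto.
  symmetry. apply is_derive_unique. now apply hL, dom.
- now apply (action_term_smooth Q D family_domain openQ openD open_family_domain
    family_domain_D Lr tr dom k).
Qed.

Lemma ex_derive_Derive_action s r : family_domain (s, r) ->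
  ex_derive (fun u => Derive (fun v => action theta (shift (c u) (X u) v) (W u)) r) s.
Proof.
intros dom.
destruct exists_action_primitive as [L [tL eL]].
destruct (action_term_partials Q D family_domain openQ openD open_family_domain
  family_domain_D L tL) as [Ls [Lr [Lt [ts [tr [tt hL]]]]]].
destruct (action_term_partials Q D family_domain openQ openD open_family_domain
  family_domain_D Lr tr) as [Lrs [Lrr [Lrt [trs [trr [trt hLr]]]]]].
exists (Lrs ((s, r), 1)).
apply (is_derive_ext_loc (fun u => Lr ((u, r), 1))); [|now apply hLr].
generalize (locally_U_l family_domain open_family_domain s r dom).
apply filter_imp. intros u du. rewrite (Derive_action_r L u r eL du).
symmetry. apply is_derive_unique. now apply hL.
Qed.

Lemma action_schwarz s r : family_domain (s, r) ->
  Derive (fun u => Derive (fun v => action theta (shift (c u) (X u) v) (W u)) r) s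
  = Derive (fun v => Derive (fun u => action theta (shift (c u) (X u) v) (W u)) s) r.
Proof.
intros dom.
destruct exists_action_primitive as [L [tL eL]].
transitivity (Derive (fun u => Derive (fun v => L ((u, v), 1)) r) s).
- apply Derive_ext_loc.
  generalize (locally_U_l family_domain open_family_domain s r dom).
  apply filter_imp. intros u du. now apply Derive_action_r.
- rewrite (action_term_schwarz Q D family_domain openQ openD open_family_domain
    family_domain_D L s r tL dom).
  symmetry. apply Derive_ext_loc.
  generalize (locally_U_r family_domain open_family_domain s r dom).
  apply filter_imp. intros v dv. now apply Derive_action_s.
Qed.
End Family.

Lemma shift_0 (z X : R -> C) : shift z X 0 = z.
Proof.
apply functional_extensionality. intros t. exact (point_shift_0 (z t) (X t)).
Qed.

Lemma family_const_domain e z X : loop_point Q e z ->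
  family_domain (fun _ => True) e (fun _ => z) (fun _ => X) (0, 0).
Proof. intros pz. split; [exact I|]. simpl. now rewrite shift_0. Qed.

(** The density is identified with the [r]-derivative of the term representing the integrand. This
    yields its continuity without an inspection of its formula, and differentiation under the
    integral gives the second claim. *)
Lemma is_derive_action e z X W :
  loop_point Q e z -> smooth_loop e X -> smooth_loop e W ->
  (forall t, continuous (action_density z X W) t) /\
  is_derive (fun r => action theta (shift z X r) W) 0 (RInt (action_density z X W) 0 1).
Proof.
intros pz lX lW. assert (lz := proj1 pz).
(* The families are constant in [s], which serves as a dummy parameter kept at [0]. *)
pose (D := fun _ : R => True).
pose (U := family_domain D e (fun _ => z) (fun _ => X)).
assert (oU : open U) by (apply open_family_domain; eauto using open_all, smooth_path_const).
assert (UD : forall s r, U (s, r) -> D s) by (intros; exact I).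
assert (U0 : U (0, 0)) by now apply family_const_domain.
destruct (exists_action_term D e (fun _ => z) (fun _ => X) (fun _ => W))
  as [body [tb eb]]; try (eauto using smooth_path_const).
destruct (action_term_partials Q D U openQ open_all oU UD body tb)
  as [fs [fr [ft [ts [tr [tt hb]]]]]].
assert (efr : forall t, fr ((0, 0), t) = action_density z X W t).
{ intros t. rewrite <- (is_derive_unique _ _ _ (proj1 (proj2 (hb 0 0 t U0)))).
  apply is_derive_unique.
  apply (is_derive_ext_loc (fun r => pullback theta (time_change (shift z X r) t)
    (point_shift (z t) (X t) r) (W t))).
  - generalize (locally_U_r U oU 0 0 U0). apply filter_imp. intros r Ur.
    symmetry. now apply eb.
  - assert (h := is_derive_pullback (fun r => time_change (shift z X r) t)
      (time_change_deriv z X t) (z t) (X t) (W t)).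
    cbv beta in h. rewrite shift_0 in h. apply h.
    + apply pz.
    + apply is_derive_time_change.
      * intros u. now apply smooth_loop_continuous with e.
      * intros u. now apply smooth_loop_continuous with e.
      * apply (L2_inner_pos e); [exact lz|apply pz]. }
split.
- intros t. apply (continuous_ext (fun t => fr ((0, 0), t))); [exact efr|].
  apply continuous_pair_r. now apply (action_term_continuous Q D U oU UD).
- rewrite <- (RInt_ext (fun t => fr ((0, 0), t))) by (intros; apply efr).
  apply (is_derive_ext_loc (fun r => RInt (fun t => body ((0, r), t)) 0 1)).
  + generalize (locally_U_r U oU 0 0 U0). apply filter_imp. intros r Ur.
    apply RInt_ext. intros t _. now apply eb.
  + apply (is_derive_primitive_param (fun u v => body ((0, u), v)) (fun u v => fr ((0, u), v))).
    * generalize (locally_U_r U oU 0 0 U0). apply filter_imp. intros u Uu v. now apply hb.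
    * generalize (locally_U_r U oU 0 0 U0). apply filter_imp. intros u Uu v.
      apply continuous_pair_r. now apply (action_term_continuous Q D U oU UD).
    * intros v. apply continuous_pair_slice_r. now apply (action_term_continuous Q D U oU UD).
Qed.

Lemma Sigma_split e z X Y :
  loop_point Q e z -> smooth_loop e X -> smooth_loop e Y ->
  Sigma theta z X Y = RInt (action_density z X Y) 0 1 - RInt (action_density z Y X) 0 1.
Proof.
intros pz lX lY. rewrite Sigma_density by apply pz.
apply (RInt_minus (V := R_CompleteNormedModule)); apply ex_RInt_of_continuous;
  now apply (is_derive_action e).
Qed.

Lemma Sigma_ext_deriv e z X Y :
  loop_point Q e z -> smooth_loop e X -> smooth_loop e Y ->
  Sigma theta z X Y = Derive (fun r => action theta (shift z X r) Y) 0
    - Derive (fun r => action theta (shift z Y r) X) 0.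
Proof.
intros pz lX lY. rewrite (Sigma_split e) by assumption.
f_equal; [|f_equal]; symmetry; apply is_derive_unique; now apply (is_derive_action e).
Qed.

Lemma Sigma_skew e z X Y :
  loop_point Q e z -> smooth_loop e X -> smooth_loop e Y ->
  Sigma theta z Y X = - Sigma theta z X Y.
Proof. intros pz lX lY. rewrite !(Sigma_split e) by assumption. ring. Qed.

(** The density is linear in the direction of displacement and in the argument of the 1-form, so the
    two integrals of [Sigma_split] are treated separately. *)
Lemma Sigma_shift e z X X' Y r :
  loop_point Q e z -> smooth_loop e X -> smooth_loop e X' -> smooth_loop e Y ->
  Sigma theta z (shift X X' r) Y = Sigma theta z X Y + r * Sigma theta z X' Y.
Proof.
intros pz lX lX' lY.
assert (lS : smooth_loop e (shift X X' r)) by now apply smooth_loop_shift.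
assert (cont : forall A, smooth_loop e A -> forall t, continuous A t)
  by (intros A lA t; now apply smooth_loop_continuous with e).
assert (h1 : RInt (action_density z (shift X X' r) Y) 0 1
  = RInt (action_density z X Y) 0 1 + r * RInt (action_density z X' Y) 0 1).
{ rewrite <- RInt_shift by now apply (is_derive_action e).
  apply RInt_ext. intros t _. unfold action_density.
  rewrite time_change_deriv_shift by (apply cont; assumption || apply pz).
  unfold pullback_dz, re2, im2, shift; simpl.
  match goal with |- ?l = ?r => change (@eq R l r) end. ring. }
assert (h2 : RInt (action_density z Y (shift X X' r)) 0 1
  = RInt (action_density z Y X) 0 1 + r * RInt (action_density z Y X') 0 1).
{ rewrite <- RInt_shift by now apply (is_derive_action e).
  apply RInt_ext. intros t _. unfold action_density.
  unfold pullback_dz, pullback_dt, re2, im2, shift; simpl.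
  match goal with |- ?l = ?r => change (@eq R l r) end. ring. }
rewrite !(Sigma_split e) by assumption. rewrite h1, h2. ring.
Qed.

(** By [Sigma_ext_deriv] the value along the curve is a difference of two [r]-derivatives of the
    action, with the roles of [X] and [Y] exchanged; each is smooth by [smooth_Derive_action]. *)
Lemma smooth_Sigma e (D : R -> Prop) (c X Y : R -> R -> C) :
  open D -> smooth_path_of_loops D c -> smooth_path_of_loops D X ->
  smooth_path_of_loops D Y ->
  (forall s, D s -> loop_point Q e (c s) /\ smooth_loop e (X s) /\ smooth_loop e (Y s)) ->
  smooth_on (V := R_NormedModule) (W := R_NormedModule) D
    (fun s => Sigma theta (c s) (X s) (Y s)).
Proof.
intros oD sc sX sY h k.
assert (dom : forall A : R -> R -> C, forall s, D s -> family_domain D e c A (s, 0)).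
{ intros A s Ds. split; [exact Ds|]. simpl. rewrite shift_0. now apply h. }
assert (lc : forall s, D s -> smooth_loop e (c s)) by (intros s Ds; now apply h).
assert (lX : forall s, D s -> smooth_loop e (X s)) by (intros s Ds; now apply h).
assert (lY : forall s, D s -> smooth_loop e (Y s)) by (intros s Ds; now apply h).
assert (h1 := smooth_Derive_action D e c X Y oD sc sX sY lc lX (dom X) k).
assert (h2 := smooth_Derive_action D e c Y X oD sc sY sX lc lY (dom Y) k).
apply (Ck_on_ext (V := R_NormedModule) (W := R_NormedModule) D k
  (fun s => plus (Derive (fun r => action theta (shift (c s) (X s) r) (Y s)) 0)
    (opp (Derive (fun r => action theta (shift (c s) (Y s) r) (X s)) 0)))).
- exact oD.
- intros s Ds. symmetry. apply (Sigma_ext_deriv e); now apply h.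
- apply (Ck_on_plus (V := R_NormedModule) (W := R_NormedModule)); [exact h1|].
  apply (Ck_on_linear (V := R_NormedModule) (W := R_NormedModule) (W' := R_NormedModule)
    D k _ opp (is_linear_opp (K := R_AbsRing)) h2).
Qed.

(** * Closedness of the magnetic form *)

Section Closedness.
Variables (e : parity) (x : R -> C).
Hypothesis px : loop_point Q e x.

Definition second_deriv (X Y Z : R -> C) : R :=
  Derive (fun s => Derive (fun r => action theta (shift (shift x X s) Y r) Z) 0) 0.

Lemma shift_comm (X Y : R -> C) s r : shift (shift x X s) Y r = shift (shift x Y r) X s.
Proof.
apply functional_extensionality. intros t. unfold shift; simpl. f_equal; ring.
Qed.

Lemma shift_domain X Y : 
  family_domain (fun _ => True) e (shift x X) (fun _ => Y) (0, 0).
Proof. split; [exact I|]. simpl. now rewrite !shift_0. Qed.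

(** Schwarz for the family whose base curve is the line from [x] along [X] and whose displacement is
    the constant [Y]; the two displacements commute. *)
Lemma second_deriv_comm X Y Z :
  smooth_loop e X -> smooth_loop e Y -> smooth_loop e Z ->
  second_deriv X Y Z = second_deriv Y X Z.
Proof.
intros lX lY lZ. unfold second_deriv.
rewrite (action_schwarz (fun _ => True) e (shift x X) (fun _ => Y) (fun _ => Z));
  eauto using open_all, smooth_path_const, smooth_path_shift, shift_domain.
- apply Derive_ext. intros r. apply Derive_ext. intros s. now rewrite shift_comm.
- eapply smooth_path_shift; [apply px|exact lX].
- intros s _. apply smooth_loop_shift; [apply px|exact lX].
Qed.

Lemma Derive_Sigma X Y Z :
  smooth_loop e X -> smooth_loop e Y -> smooth_loop e Z ->
  Derive (fun s => Sigma theta (shift x X s) Y Z) 0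
  = second_deriv X Y Z - second_deriv X Z Y.
Proof.
intros lX lY lZ.
assert (lx := proj1 px).
assert (sx := smooth_path_shift e x X lx lX).
assert (ls : forall s, True -> smooth_loop e (shift x X s))
  by (intros s _; now apply smooth_loop_shift).
assert (oU : forall A, smooth_loop e A ->
  open (family_domain (fun _ => True) e (shift x X) (fun _ => A)))
  by (intros A lA; apply open_family_domain; eauto using open_all, smooth_path_const).
unfold second_deriv. rewrite <- Derive_minus.
- apply Derive_ext_loc.
  (* Openness of the domain is stated for a family with some direction; at second parameter [0] that
     direction drops out, leaving that [shift x X s] is a point of the loop space for [s] near
     [0]. *)
  pose (zero_loop := shift X X (-1)).
  assert (l0 : smooth_loop e zero_loop) by now apply smooth_loop_shift.
  generalize (locally_U_l _ (oU zero_loop l0) 0 0 (shift_domain X zero_loop)).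
  apply filter_imp. intros s [_ ps]. simpl in ps. rewrite shift_0 in ps.
  now apply (Sigma_ext_deriv e).
- apply (ex_derive_Derive_action (fun _ => True) e (shift x X) (fun _ => Y) (fun _ => Z));
    eauto using open_all, smooth_path_const, shift_domain.
- apply (ex_derive_Derive_action (fun _ => True) e (shift x X) (fun _ => Z) (fun _ => Y));
    eauto using open_all, smooth_path_const, shift_domain.
Qed.

(** [Derive_Sigma] produces six second derivatives of the 1-form, which cancel in pairs once the
    first two directions may be exchanged. *)
Lemma Sigma_closed_at X Y Z :
  smooth_loop e X -> smooth_loop e Y -> smooth_loop e Z ->
  Derive (fun s => Sigma theta (shift x X s) Y Z) 0
  - Derive (fun s => Sigma theta (shift x Y s) X Z) 0
  + Derive (fun s => Sigma theta (shift x Z s) X Y) 0 = 0.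
Proof.
intros lX lY lZ. rewrite !Derive_Sigma by assumption.
rewrite (second_deriv_comm Y X Z), (second_deriv_comm Z X Y), (second_deriv_comm Z Y X)
  by assumption.
ring.
Qed.
End Closedness.

(** * The forms on the loop space and on its cotangent bundle *)

Lemma Sigma_zero e z X : loop_point Q e z -> smooth_loop e X ->
  Sigma theta z X (zero : paths) = 0.
Proof.
intros pz lX. rewrite (zero_shift (X : paths)).
rewrite (Sigma_skew e), (Sigma_shift e) by (auto using smooth_loop_shift).
ring.
Qed.

Lemma Sigma_two_form : is_two_form (loop_space Q) (Sigma theta).
Proof.
split.
- intros e x X X' Y px lX lX' lY.
  change (Sigma theta x (plus (X : paths) X') Y = Sigma theta x X Y + Sigma theta x X' Y).
  rewrite plus_shift.
  rewrite (Sigma_shift e) by assumption. ring.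
- intros e x a X Y px lX lY.
  change (Sigma theta x (scal a (X : paths)) Y = a * Sigma theta x X Y).
  rewrite scal_shift.
  rewrite (Sigma_shift e) by assumption. ring.
- exact Sigma_skew.
- intros e x X Y _ _ _. apply Sigma_opp.
- exact smooth_Sigma.
Qed.

Lemma Sigma_closed : is_closed (loop_space Q) (Sigma theta).
Proof.
intros e x X Y Z px lX lY lZ. exact (Sigma_closed_at e x px X Y Z lX lY lZ).
Qed.

Lemma Omega_two_form : is_two_form (cotangent Q) (Omega theta).
Proof.
split.
- intros e [x xi] [X H] [X' H'] [Y K] [px lxi] [lX lH] [lX' lH'] [lY lK].
  change (L2_inner (plus (H : paths) H') Y - L2_inner K (plus (X : paths) X')
    + Sigma theta x (plus (X : paths) X') Y
    = L2_inner H Y - L2_inner K X + Sigma theta x X Y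
      + (L2_inner H' Y - L2_inner K X' + Sigma theta x X' Y)).
  rewrite !plus_shift, (L2_inner_shift_l e), (L2_inner_shift_r e), (Sigma_shift e)
    by assumption.
  ring.
- intros e [x xi] a [X H] [Y K] [px lxi] [lX lH] [lY lK].
  change (L2_inner (scal a (H : paths)) Y - L2_inner K (scal a (X : paths))
    + Sigma theta x (scal a (X : paths)) Y
    = a * (L2_inner H Y - L2_inner K X + Sigma theta x X Y)).
  rewrite !scal_shift, (L2_inner_shift_l e), (L2_inner_shift_r e), (Sigma_shift e)
    by assumption.
  ring.
- intros e [x xi] [X H] [Y K] [px lxi] [lX lH] [lY lK].
  unfold Omega, Omega_can. simpl fst; simpl snd.
  rewrite (Sigma_skew e x X Y) by assumption. ring.
- intros e [x xi] [X H] [Y K] [px lxi] [lX lH] [lY lK].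
  change (L2_inner (opp (H : paths)) (opp (Y : paths))
    - L2_inner (opp (K : paths)) (opp (X : paths))
    + Sigma theta (opp (x : paths)) (opp (X : paths)) (opp (Y : paths))
    = L2_inner H Y - L2_inner K X + Sigma theta x X Y).
  now rewrite !L2_inner_opp, Sigma_opp.
- intros e D c X Y oD [sc sc'] [sX sX'] [sY sY'] h k.
  apply (Ck_on_plus (V := R_NormedModule) (W := R_NormedModule) D k
    (fun s => L2_inner (snd (X s)) (fst (Y s)) - L2_inner (snd (Y s)) (fst (X s)))
    (fun s => Sigma theta (fst (c s)) (fst (X s)) (fst (Y s)))).
  + apply (Ck_on_plus (V := R_NormedModule) (W := R_NormedModule) D k
      (fun s => L2_inner (snd (X s)) (fst (Y s)))
      (fun s => opp (L2_inner (snd (Y s)) (fst (X s))))).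
    * now apply smooth_L2_inner.
    * apply (Ck_on_linear (V := R_NormedModule) (W := R_NormedModule) (W' := R_NormedModule)
        D k (fun s => L2_inner (snd (Y s)) (fst (X s))) opp (is_linear_opp (K := R_AbsRing))).
      now apply smooth_L2_inner.
  + apply (smooth_Sigma e); auto.
    intros s Ds. destruct (h s Ds) as [[p1 _] [[p2 _] [p3 _]]]. auto.
Qed.

(** The difference quotients coincide, so no differentiability is asked of [f]. It discards
    [Omega_can] from the exterior derivative: on constant vector fields its value does not depend on
    the base point. *)
Lemma Derive_const_plus (a : R) (f : R -> R) x : Derive (fun s => a + f s) x = Derive f x.
Proof.
unfold Derive. f_equal. apply Lim_ext. intros h. f_equal. ring.
Qed.

Lemma Omega_closed : is_closed (cotangent Q) (Omega theta).
Proof.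
intros e [x xi] [X H] [Y K] [Z L] [px lxi] [lX lH] [lY lK] [lZ lL].
rewrite <- (Sigma_closed_at e x px X Y Z lX lY lZ).
apply (f_equal2 Rplus); [apply (f_equal2 Rminus)|].
- exact (Derive_const_plus (L2_inner K Z - L2_inner L Y)
    (fun s => Sigma theta (shift x X s) Y Z) 0).
- exact (Derive_const_plus (L2_inner H Z - L2_inner L X)
    (fun s => Sigma theta (shift x Y s) X Z) 0).
- exact (Derive_const_plus (L2_inner H Y - L2_inner K X)
    (fun s => Sigma theta (shift x Z s) X Y) 0).
Qed.

Lemma nonzero_path (X : paths) : X <> zero -> exists t, X t <> RtoC 0.
Proof.
intros nX. apply Classical_Prop.NNPP. intros h. apply nX.
apply functional_extensionality. intros t. apply Classical_Prop.NNPP. intros n.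
apply h. now exists t.
Qed.

Lemma L2_inner_zero_r (z : R -> C) : L2_inner z (zero : paths) = 0.
Proof.
unfold L2_inner. rewrite (RInt_ext _ (fun _ => 0)).
- rewrite RInt_const. apply (scal_zero_r (V := R_NormedModule)).
- intros t _. change (fst (z t) * 0 + snd (z t) * 0 = 0). ring.
Qed.

Lemma zero_loop e (X : R -> C) : smooth_loop e X -> smooth_loop e (zero : paths).
Proof. intros lX. rewrite (zero_shift (X : paths)). now apply smooth_loop_shift. Qed.

Lemma Omega_nondegenerate : is_weakly_nondegenerate (cotangent Q) (Omega theta).
Proof.
intros e [x xi] [X H] [px lxi] [lX lH] nz. simpl in lX, lH, px.
destruct (Classical_Prop.classic ((X : paths) = zero)) as [eX|nX].
- assert (nH : (H : paths) <> zero) by (intros eH; apply nz; now rewrite eX, eH).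
  exists (H, (zero : paths)). split; [split; [exact lH|exact (zero_loop e X lX)]|].
  unfold Omega, Omega_can; simpl fst; simpl snd.
  rewrite (Sigma_skew e x H X) by assumption. rewrite eX.
  rewrite (Sigma_zero e) by assumption. rewrite L2_inner_zero_r.
  pose proof (L2_inner_pos e H lH (nonzero_path _ nH)). lra.
- exists ((zero : paths), X). split; [split; [exact (zero_loop e X lX)|exact lX]|].
  unfold Omega, Omega_can; simpl fst; simpl snd.
  rewrite (Sigma_zero e) by assumption. rewrite L2_inner_zero_r.
  pose proof (L2_inner_pos e X lX (nonzero_path _ nX)). lra.
Qed.
End MagneticForm.

Theorem theoremB2 (Q : C -> Prop) (theta : R -> C -> C -> R)
    (openQ : open Q) (zeroQ : Q (RtoC 0)) (htheta : twisted_periodic Q theta) :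
  (is_two_form (loop_space Q) (Sigma theta)
   /\ is_closed (loop_space Q) (Sigma theta))
  /\ is_weak_symplectic (cotangent Q) (Omega theta).
Proof.
destruct htheta as [smooth_theta _].
(* The partial derivatives of the two components of [theta] are fixed here once and passed to all
   five claims. *)
destruct (smooth_st_partials Q openQ (fun p => theta (fst p) (snd p) (1, 0)))
  as [ga1 [ga2 [ga3 [a1 [a2 [_ pa]]]]]]; [apply smooth_theta|].
destruct (smooth_st_partials Q openQ (fun p => theta (fst p) (snd p) (0, 1)))
  as [gb1 [gb2 [gb3 [b1 [b2 [_ pb]]]]]]; [apply smooth_theta|].
split; [split|split; [|split]].
- exact (Sigma_two_form Q theta openQ smooth_theta ga1 ga2 ga3 gb1 gb2 gb3 a1 a2 b1 b2 pa pb).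
- exact (Sigma_closed Q theta openQ smooth_theta ga1 ga2 ga3 gb1 gb2 gb3 a1 a2 b1 b2 pa pb).
- exact (Omega_two_form Q theta openQ smooth_theta ga1 ga2 ga3 gb1 gb2 gb3 a1 a2 b1 b2 pa pb).
- exact (Omega_closed Q theta openQ smooth_theta ga1 ga2 ga3 gb1 gb2 gb3 a1 a2 b1 b2 pa pb).
- exact (Omega_nondegenerate Q theta openQ smooth_theta ga1 ga2 ga3 gb1 gb2 gb3 a1 a2 b1 b2 pa pb).
Qed.
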